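(* Let $\phi:H_{\bar0}\to W_{\bar1}$ be a derivation (i.e. $\phi$ is linear and $\phi([x,y])=[\phi(x),y]+[x,\phi(y)]$ for all $x,y\in H_{\bar0}$) with $\phi(\mathcal J)=0$. Then: (1) if $n$ is even, $\phi=0$; (2) if $n$ is odd, then $\phi(D_H(x^{(\pi)}))=\mu D_H(x^\omega)$ for some $\mu\in\mathbb F$. Conversely, when $n$ is odd, for every $\mu\in\mathbb F$ the linear map $\Gamma_\mu:H_{\bar0}\to W_{\bar1}$ with $\Gamma_\mu(\mathcal J)=0$ and $\Gamma_\mu(D_H(x^{(\pi)}))=\mu D_H(x^\omega)$ is a derivation from $H_{\bar0}$ into $W_{\bar1}$.
   Context: Let $\mathbb F$ be an algebraically closed field of characteristic $p>3$. Fix positive integers $m=2r$ and $n$; write $n=2s$ if $n$ is even and $n=2s+1$ if $n$ is odd. Put $I_0=\{1,\dots,m\}$, $I_1=\{m+1,\dots,m+n\}$, $I=I_0\cup I_1$. Fix positive integers $t_1,\dots,t_m$, put $\pi=(\pi_1,\dots,\pi_m)$ with $\pi_i=p^{t_i}-1$, and $\mathbb A=\{\alpha\in\mathbb N_0^m:\alpha_i\le\pi_i\ \forall i\}$; $\varepsilon_i$ is the $i$-th unit vector and $|\alpha|=\sum\alpha_i$. Let $\mathbb B$ be the set of strictly increasing sequences $u=\langle i_1<\dots<i_k\rangle$ of elements of $I_1$ (including the empty one $\emptyset$), $|u|=k$, $\mathbb B^0=\{u\in\mathbb B:|u|\text{ even}\}$, $\omega=\langle m+1,\dots,m+n\rangle$.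 Let $\mathcal O=\mathcal O(m,n;\underline t)$ be the supercommutative associative superalgebra with basis $x^{(\alpha)}x^u$ ($\alpha\in\mathbb A,u\in\mathbb B$), where $x^{(\alpha)}x^{(\beta)}=\binom{\alpha+\beta}{\alpha}x^{(\alpha+\beta)}$, $x^{(\alpha)}$ even, $x_{m+1},\dots,x_{m+n}$ odd and pairwise anticommuting, $x^u=x_{i_1}\cdots x_{i_k}$, $x^\emptyset=1$, $x_i:=x^{(\varepsilon_i)}$ for $i\in I_0$. $\mathcal O$ is $\mathbb Z$-graded by $\mathrm{zd}(x^{(\alpha)}x^u)=|\alpha|+|u|$. For $i\in I$ let $\partial_i$ be the superderivation of $\mathcal O$ with $\partial_i(x^{(\alpha)})=x^{(\alpha-\varepsilon_i)}$ for $i\in I_0$ and $\partial_i(x_k)=\delta_{ik}$ for $i\in I_1$; its parity is $\mu(i)=\bar0$ for $i\in I_0$, $\mu(i)=\bar1$ for $i\in I_1$. $W=\{\sum_{i\in I}f_i\partial_i: f_i\in\mathcal O\}$ is the Lie superalgebra with bracket $[f\partial_i,g\partial_j]=f\partial_i(g)\partial_j-(-1)^{p(f\partial_i)p(g\partial_j)}g\partial_j(f)\partial_i$, $\mathbb Z$-graded by $\mathrm{zd}(f\partial_j)=\mathrm{zd}(f)-1$, with even and odd parts $W_{\bar 0},W_{\bar1}$. Define $i'=i+r$ ($1\le i\le r$), $i'=i-r$ ($r<i\le m$), $i'=i+s$ ($m<i\le m+s$), $i'=i-s$ ($m+s<i\le m+2s$), and $i'=i$ otherwise; $\tau(i)=1$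 for $1\le i\le r$, $\tau(i)=-1$ for $r<i\le m$, $\tau(i)=1$ for $i\in I_1$. For $f\in\mathcal O$ put $D_H(f)=\sum_{i\in I}\tau(i)(-1)^{\mu(i)p(f)}\partial_i(f)\partial_{i'}$. Let $H_{\bar0}=\mathrm{span}_{\mathbb F}\{D_H(x^{(\alpha)}x^u):\alpha\in\mathbb A,u\in\mathbb B^0,(\alpha,u)\ne(\pi,\omega)\}$, a $\mathbb Z$-graded subalgebra of $W_{\bar0}$ with $\mathrm{zd}(D_H(f))=\mathrm{zd}(f)-2$, and $\mathcal J=\mathrm{span}_{\mathbb F}\{D_H(x^{(\alpha)}x^u):\alpha\in\mathbb A,u\in\mathbb B^0,(\alpha,u)\ne(\pi,\omega),(\alpha,u)\ne(\pi,\emptyset)\}$, an ideal of $H_{\bar0}$ with $H_{\bar0}=\mathcal J\oplus\mathbb F D_H(x^{(\pi)})$. $W_{\bar1}$ is an $H_{\bar0}$-module via the bracket of $W$. *)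

(* Defs.v *)
From HB Require Import structures.
From mathcomp Require Import all_boot all_order all_algebra.
Set Implicit Arguments. Unset Strict Implicit. Unset Printing Implicit Defensive.
Import Order.TTheory GRing.Theory Num.Theory.
Local Open Scope ring_scope.

(* Conventions (0-based indices):
   - I_0 = {1..m} is 'I_m (i <-> i-1), I_1 = {m+1..m+n} is 'I_n (i <-> i-m-1);
     the full index set I is the sum type 'I_m + 'I_n (inl = even, inr = odd).
   - m = r.*2 ; pi : 'I_m -> nat is the truncation vector (pi_i = p^t_i - 1).
   - A multi-index alpha in \mathbb A is an element of [Alpha], a sequence of
     values in 'I_(Mx.+1) (Mx = max pi) subject to alpha_i <= pi_i.
   - u in \mathbb B is a subset of 'I_n (strictly increasing sequence).
   - O = functions (Alpha * {set 'I_n}) -> F : coordinates on the basis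
     x^(alpha) x^u.
   - W = functions I -> O : f = (f_i)_i stands for sum_i f_i d_i. *)

Section HamiltonDefs.
Variables (F : fieldType) (r n : nat) (pi : 'I_(r.*2) -> nat).
Local Notation m := (r.*2).

Definition Mx : nat := \max_(i < m) pi i.
Definition alpha_ok (a : {ffun 'I_m -> 'I_Mx.+1}) : bool := [forall i, (a i <= pi i)%N].
Definition Alpha := {a : {ffun 'I_m -> 'I_Mx.+1} | alpha_ok a}.
Definition Mon := (Alpha * {set 'I_n})%type.
Definition Ix := ('I_m + 'I_n)%type.
Local Notation Oalg := {ffun Mon -> F^o}.
Local Notation Wder := {ffun Ix -> Oalg}.

Definition aval (a : Alpha) (i : 'I_m) : nat := sval a i.

Definition mono (k : Mon) : Oalg := [ffun l => (l == k)%:R].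

Definition mon_par (k : Mon) : bool := odd #|k.2|.

Definition ipar (i : Ix) : bool := if i is inr _ then true else false.

Lemma piA_ok : alpha_ok [ffun i => inord (pi i)].
Proof.
apply/forallP => i; rewrite ffunE inordK //.
by rewrite ltnS; apply: (leq_bigmax_cond (P := xpredT) (F := pi) i).
Qed.
Definition piA : Alpha := exist (fun a => is_true (alpha_ok a)) _ piA_ok.

Definition addA (a b : Alpha) : option Alpha :=
  if [forall i, (aval a i + aval b i <= pi i)%N]
  then insub [ffun i => inord (aval a i + aval b i) : 'I_Mx.+1]
  else None.

Definition subA (a : Alpha) (i : 'I_m) : option Alpha :=
  if (0 < aval a i)%N
  then insub [ffun j => inord (if j == i then (aval a j).-1 else aval a j) : 'I_Mx.+1]
  else None.

Definition binomA (a b : Alpha) : nat :=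
  \prod_(i < m) 'C(aval a i + aval b i, aval a i).

Definition monmul (k l : Mon) : Oalg :=
  match addA k.1 l.1 with
  | Some c =>
      if [disjoint k.2 & l.2] then
        ((binomA k.1 l.1)%:R * (-1) ^+ #|[set ij : 'I_n * 'I_n |
            (ij.1 \in k.2) && (ij.2 \in l.2) && (ij.2 < ij.1)%N]|)
          *: mono (c, k.2 :|: l.2)
      else 0
  | None => 0
  end.

Definition mulO (f g : Oalg) : Oalg :=
  \sum_(k : Mon) \sum_(l : Mon) (f k * g l) *: monmul k l.

Definition dmon (i : Ix) (k : Mon) : Oalg :=
  match i with
  | inl i0 => if subA k.1 i0 is Some b then mono (b, k.2) else 0
  | inr j => if j \in k.2 then
               (-1) ^+ #|[set l in k.2 | (l < j)%N]| *: mono (k.1, k.2 :\ j)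
             else 0
  end.

Definition dO (i : Ix) (f : Oalg) : Oalg := \sum_(k : Mon) f k *: dmon i k.

Definition fdi (f : Oalg) (i : Ix) : Wder := [ffun j => if j == i then f else 0].

Definition iprime (i : Ix) : Ix :=
  match i with
  | inl k => inl (if (k < r)%N then insubd k (k + r)%N else insubd k (k - r)%N)
  | inr j => inr (if (j < n./2)%N then insubd j (j + n./2)%N
                  else if (j < (n./2).*2)%N then insubd j (j - n./2)%N else j)
  end.

Definition tau (i : Ix) : F :=
  match i with
  | inl k => if (k < r)%N then 1 else -1
  | inr _ => 1
  end.

Definition DH (k : Mon) : Wder :=
  \sum_(i : Ix) (tau i * (-1) ^+ (ipar i && mon_par k)) *: fdi (dO i (mono k)) (iprime i).

Definition wpar (k : Mon) (i : Ix) : bool := mon_par k (+) ipar i.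

Definition brE (k : Mon) (i : Ix) (l : Mon) (j : Ix) : Wder :=
  fdi (mulO (mono k) (dO i (mono l))) j
  - (-1) ^+ (wpar k i && wpar l j) *: fdi (mulO (mono l) (dO j (mono k))) i.

Definition brW (X Y : Wder) : Wder :=
  \sum_(i : Ix) \sum_(k : Mon) \sum_(j : Ix) \sum_(l : Mon)
     (X i k * Y j l) *: brE k i l j.

Definition inW1 (X : Wder) : Prop :=
  forall (i : Ix) (k : Mon), ~~ wpar k i -> X i k = 0.

Definition monPi : Mon := (piA, set0).
Definition monPiOmega : Mon := (piA, setT).

Lemma zeroA_ok : alpha_ok [ffun => ord0].
Proof. by apply/forallP => i; rewrite ffunE. Qed.
Definition zeroA : Alpha := exist (fun a => is_true (alpha_ok a)) _ zeroA_ok.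

Definition monXomega : Mon := (zeroA, setT).

Definition H0idx (k : Mon) : bool := ~~ odd #|k.2| && (k != monPiOmega).
Definition Jidx (k : Mon) : bool := H0idx k && (k != monPi).

Definition inDHspan (P : pred Mon) (X : Wder) : Prop :=
  exists c : Mon -> F, X = \sum_(k | P k) c k *: DH k.

Definition inH0 := inDHspan H0idx.
Definition inJ := inDHspan Jidx.

(* phi : H_0 -> W_1 is a linear map (we model it as a function on W whose
   restriction to H_0 is considered) *)
Definition lin_H0_W1 (phi : Wder -> Wder) : Prop :=
  (forall (a : F) (x y : Wder), inH0 x -> inH0 y -> phi (a *: x + y) = a *: phi x + phi y)
  /\ (forall x, inH0 x -> inW1 (phi x)).

Definition is_derivation (phi : Wder -> Wder) : Prop :=
  lin_H0_W1 phi /\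
  forall x y, inH0 x -> inH0 y -> phi (brW x y) = brW (phi x) y + brW x (phi y).

End HamiltonDefs.

(* Main.v *)
(* The image w of D_H(x^(pi)) decides everything: since J is an ideal killed by
   phi, w is an odd element of W centralizing J.  The fields D_H(x_i) and
   D_H(x^(2 eps_i)), i in I_0, force w = sum_{l in I_1} w_l d_l with w_l in the
   exterior algebra; the D_H(x_i x_j x_k), j, k in I_1, give w_j x_k = w_k x_j,
   which leaves in w_l only x^omega and the x^(omega - j); the torus spanned by
   the D_H(x_j x_j') then kills everything unless n is odd and j = l', and the
   D_H(x_l x_z), z the self-paired index, tie all remaining coefficients to
   that of d_z.  So the centralizer is spanned by D_H(x^omega) (n odd) or is 0.
   That J contains [H_0, H_0] and that D_H(x^omega) centralizes H_0 both follow from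
   [D_H f, D_H g] = D_H {f, g} and from {f, g} being a divergence. *)
Require Import Defs.
From HB Require Import structures.
From mathcomp Require Import all_boot all_order all_algebra.
From mathcomp Require Import zify ring.
Import Order.TTheory GRing.Theory Num.Theory.
Local Open Scope ring_scope.

Set Implicit Arguments.
Unset Strict Implicit.
Unset Printing Implicit Defensive.

(** * Structure constants of the superalgebra and its derivations in coordinates *)

Section Coordinates.
Variables (F : fieldType) (r n : nat) (pi : 'I_(r.*2) -> nat).
Local Notation m := (r.*2).
Local Notation Mon := (Mon n pi).
Local Notation Alpha := (Alpha pi).
Local Notation Ix := (Ix r n).
Local Notation Oalg := {ffun Mon -> F^o}.
Local Notation Wder := {ffun Ix -> Oalg}.
Implicit Types (a b c : Alpha) (i : 'I_m) (u v w : {set 'I_n}) (j : 'I_n).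
Implicit Types (f g h : Oalg) (k l x : Mon) (q : bool).

(** The obstacle is the truncation: x^(a) x^(b) becomes 0 as soon as an exponent exceeds [pi i], and
    [d_i] respects the Leibniz rule across that cut only because C(p^t, e) = 0 in F for 0 < e < p^t.
    The formula for [D_H f, D_H g] rests on this. The same cut is what makes a divergence useful: no
    even [d_i] produces a monomial whose exponents are all maximal, so the coefficients of {f, g} at
    x^(pi) and at x^(pi) x^omega can only come from the odd directions. There the first dies by
    parity, the second because the image of [d_j] contains no x_j. For D_H(x^omega) the divergence
    is used differently: d_j x^omega misses only x_j, so an even monomial containing odd variables
    annihilates it before any outer derivative is applied. Where the exterior coefficients are cut
    down, the point is that a sign change under each exchange of two missing indices, followed
    around three indices, gives c = -c; this is one of the uses of characteristic different from
    2. *)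

Lemma pi_lt_Mx i : (pi i < (Mx pi).+1)%N.
Proof. by rewrite ltnS; apply: (leq_bigmax_cond (P := xpredT) (F := pi) i). Qed.

Lemma aval_le a i : (aval a i <= pi i)%N.
Proof. by have /forallP/(_ i) := valP a. Qed.

Lemma aval_inj a b : (forall i, aval a i = aval b i) -> a = b.
Proof. by move=> eq_ab; apply/val_inj/ffunP => i; apply/val_inj/eq_ab. Qed.

Lemma aval_insub (e : 'I_m -> nat) : (forall i, e i <= pi i)%N ->
  exists2 c : Alpha,
    insub [ffun i => inord (e i) : 'I_(Mx pi).+1] = Some c & aval c =1 e.
Proof.
move=> le_e; have ok_e : alpha_ok [ffun i => inord (e i) : 'I_(Mx pi).+1].
  apply/forallP => i; rewrite ffunE inordK //.
  exact: leq_ltn_trans (le_e i) (pi_lt_Mx i).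
exists (Sub _ ok_e); first exact: insubT.
move=> i; rewrite /aval /= ffunE inordK //.
exact: leq_ltn_trans (le_e i) (pi_lt_Mx i).
Qed.

(** The default [zeroA] is reached only by exponents out of range; [aval_mkA] and everything built
    on it ask for the bounds. *)
Definition mkA (e : 'I_m -> nat) : Alpha :=
  odflt (zeroA pi) (insub [ffun i => inord (e i) : 'I_(Mx pi).+1]).

Lemma aval_mkA (e : 'I_m -> nat) : (forall i, e i <= pi i)%N -> aval (mkA e) =1 e.
Proof. by move=> /aval_insub[c eq_c ce]; rewrite /mkA eq_c. Qed.

Lemma aval_zeroA i : aval (zeroA pi) i = 0%N.
Proof. by rewrite /aval /= ffunE. Qed.

Lemma aval_piA i : aval (piA pi) i = pi i.
Proof. by rewrite /aval /= ffunE inordK // pi_lt_Mx. Qed.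

Definition setA a i (e : nat) : Alpha := mkA (fun i0 => if i0 == i then e else aval a i0).

Lemma aval_setA a i (e : nat) : (e <= pi i)%N ->
  aval (setA a i e) =1 fun i0 => if i0 == i then e else aval a i0.
Proof.
by move=> le_v; apply: aval_mkA => i0; case: eqP => [->|] //; rewrite aval_le.
Qed.

Lemma subA_None a i : aval a i = 0%N -> subA a i = None.
Proof. by rewrite /subA => ->. Qed.

Lemma subA_Some a i : (0 < aval a i)%N -> subA a i = Some (setA a i (aval a i).-1).
Proof.
move=> a_gt0; rewrite /subA a_gt0 /setA /mkA.
rewrite (_ : [ffun _ => _] = [ffun i0 => inord (if i0 == i then (aval a i).-1 else aval a i0)]).
  case: (@aval_insub (fun i0 => if i0 == i then (aval a i).-1 else aval a i0)).
    move=> i0; case: eqP => [->|_]; rewrite ?aval_le //.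
    by rewrite (leq_trans (leq_pred _)) ?aval_le.
  by move=> c ->.
by apply/ffunP => i0; rewrite !ffunE; case: eqP => [->|].
Qed.

(* The truncation [x^(a) x^(b) = 0] when [a + b] leaves the index set is
   automatic here: [c] ranges over admissible multi-indices only. *)
Definition coefA a b c : F :=
  \prod_i ((aval a i + aval b i == aval c i)%N%:R * 'C(aval c i, aval a i)%:R).

Lemma coefA_addA a b c : (if Defs.addA a b is Some d then (binomA a b)%:R * (c == d)%:R else 0) =
  coefA a b c.
Proof.
rewrite /Defs.addA; case: forallP => [ok|nok]; last first.
  have [i nle] : exists i, ~~ (aval a i + aval b i <= pi i)%N.
    by apply/existsP; rewrite -negb_forall; apply/negP => /forallP.
  rewrite /coefA (bigD1 i) //= (negbTE (_ : _ != aval c i)) ?mul0r ?mul0r //.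
  by apply: contraNneq nle => ->; apply: aval_le.
have [d -> dE] := aval_insub ok.
have [->|neq_cd] := eqVneq c d.
  rewrite mulr1 /coefA /binomA natr_prod; apply: eq_bigr => i _.
  by rewrite dE eqxx mul1r.
rewrite mulr0 /coefA.
have [i nle] : exists i, aval c i != aval d i.
  apply/existsP; rewrite -negb_forall; apply: contra neq_cd => /forallP eq_cd.
  by apply/eqP/aval_inj => i; apply/eqP.
by rewrite (bigD1 i) //= -dE eq_sym (negbTE nle) !mul0r.
Qed.

Definition inv u v : nat :=
  #|[set ij : 'I_n * 'I_n | (ij.1 \in u) && (ij.2 \in v) && (ij.2 < ij.1)%N]|.

Definition coefB u v w : F :=
  ([disjoint u & v] && (u :|: v == w))%:R * (-1) ^+ inv u v.

(** The constants split into a divided power factor and an exterior factor, so commutation and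
    Leibniz rules can be checked on each factor separately. *)
Lemma monmulE k l x : monmul F k l x = coefA k.1 l.1 x.1 * coefB k.2 l.2 x.2.
Proof.
rewrite -coefA_addA /monmul /coefB -/(inv k.2 l.2).
case: (Defs.addA k.1 l.1) => [c|]; last by rewrite ffunE mul0r.
case: [disjoint _ & _]; last by rewrite ffunE /= mul0r mulr0.
rewrite !ffunE /= /GRing.scale /= [x]surjective_pairing xpair_eqE /= eq_sym.
rewrite -!mulrA; congr (_ * _).
by rewrite (eq_sym _ x.2) (eq_sym c); case: eqP; case: eqP; rewrite !(mul1r, mulr1, mul0r, mulr0).
Qed.

Lemma mulOE f g x : mulO f g x = \sum_k \sum_l f k * g l * monmul F k l x.
Proof. by rewrite sum_ffunE; apply: eq_bigr => k _; rewrite sum_ffunE; apply: eq_bigr => l _;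
  rewrite ffunE. Qed.

Lemma ffun_scaleE (T : finType) (c : F) (f : {ffun T -> F^o}) (y : T) : (c *: f) y = c * f y.
Proof. by rewrite ffunE. Qed.

Lemma mulO_linl g : linear ((fun f => mulO f g) : Oalg -> Oalg).
Proof.
move=> c f1 f2; apply/ffunP => x; rewrite [RHS]ffunE ffun_scaleE !mulOE mulr_sumr -big_split.
apply: eq_bigr => k _; rewrite mulr_sumr -big_split; apply: eq_bigr => l _.
by rewrite !ffunE /= /GRing.scale /=; ring.
Qed.

Lemma mulO_linr f : linear (mulO f : Oalg -> Oalg).
Proof.
move=> c f1 f2; apply/ffunP => x; rewrite [RHS]ffunE ffun_scaleE !mulOE mulr_sumr -big_split.
apply: eq_bigr => k _; rewrite mulr_sumr -big_split; apply: eq_bigr => l _.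
by rewrite !ffunE /= /GRing.scale /=; ring.
Qed.

(** The arguments are swapped so that the product can carry a linear structure in its left factor as
    well. *)
Definition mulOr g f : Oalg := mulO f g.

HB.instance Definition _ f := GRing.isLinear.Build F Oalg Oalg _ (mulO f) (mulO_linr f).
HB.instance Definition _ g := GRing.isLinear.Build F Oalg Oalg _ (mulOr g) (mulO_linl g).

Lemma dO_lin (s : Ix) : linear (dO s : Oalg -> Oalg).
Proof.
move=> c f1 f2; rewrite /dO scaler_sumr -big_split; apply: eq_bigr => k _.
by rewrite !ffunE scalerDl scalerA.
Qed.

HB.instance Definition _ (s : Ix) := GRing.isLinear.Build F Oalg Oalg _ (dO s) (dO_lin s).

Lemma sum_unique (T : finType) (V : nmodType) (G : T -> V) (y : T) :
  (forall z, z != y -> G z = 0) -> \sum_z G z = G y.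
Proof. by move=> G0; rewrite (bigD1 y) // big1 ?Monoid.mulm1. Qed.

Lemma monoE k x : mono F k x = (x == k)%:R.
Proof. exact: ffunE. Qed.

Lemma mono_sum f : f = \sum_k f k *: mono F k.
Proof.
apply/ffunP => x; rewrite sum_ffunE (sum_unique (y := x)) => [|k neq_k].
  by rewrite ffun_scaleE monoE eqxx mulr1.
by rewrite ffun_scaleE monoE eq_sym (negbTE neq_k) mulr0.
Qed.

Lemma sum_mono (V : lmodType F) (G : Mon -> V) k0 : \sum_k mono F k0 k *: G k = G k0.
Proof.
rewrite (sum_unique (y := k0)) => [|k /negbTE neq]; first by rewrite monoE eqxx scale1r.
by rewrite monoE neq scale0r.
Qed.

Lemma dO_mono (s : Ix) k : dO s (mono F k) = dmon F s k.
Proof. exact: sum_mono. Qed.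

Lemma mulO_mono k l : mulO (mono F k) (mono F l) = monmul F k l.
Proof.
rewrite /mulO; under eq_bigr do under eq_bigr do rewrite -scalerA.
by under eq_bigr do rewrite -scaler_sumr sum_mono; rewrite sum_mono.
Qed.

Lemma mulOsum f g : mulO f g = \sum_k \sum_l (f k * g l) *: mulO (mono F k) (mono F l).
Proof. by apply: eq_bigr => k _; apply: eq_bigr => l _; rewrite mulO_mono. Qed.

(** Exactly one monomial can be sent to [x], namely [x] with its [i]-th exponent raised by one; at
    the maximal exponent there is none. *)
Lemma dO_even i f x : dO (inl i) f x =
  if (aval x.1 i < pi i)%N then f (setA x.1 i (aval x.1 i).+1, x.2) else 0.
Proof.
rewrite /dO sum_ffunE; case: ifP => [lt_x|ge_x].
  set y := setA _ _ _; have yE : aval y =1 _ := aval_setA x.1 lt_x.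
  rewrite (sum_unique (y := (y, x.2))) => [|k neq_k].
    rewrite ffun_scaleE /= subA_Some ?yE ?eqxx //= monoE (_ : setA _ _ _ = x.1).
      by rewrite -surjective_pairing eqxx mulr1.
    apply: aval_inj => i0; rewrite aval_setA ?(ltnW lt_x) // yE.
    by case: eqP => [->|].
  rewrite ffun_scaleE /=; case k_i: (aval k.1 i) => [|e].
    by rewrite subA_None // ffunE mulr0.
  rewrite subA_Some k_i //= monoE [x]surjective_pairing xpair_eqE.
  have [x1|] /= := eqVneq x.1; last by rewrite mulr0.
  case: eqP => [x2|]; last by rewrite mulr0.
  case/eqP: neq_k; rewrite [k]surjective_pairing; congr (_, _); last by rewrite x2.
  have le_e : (e <= pi i)%N by rewrite ltnW // -k_i aval_le.
  apply: aval_inj => i0; rewrite yE x1 !(aval_setA k.1 le_e) eqxx.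
  by case: eqP => // ->.
rewrite big1 // => k _; rewrite ffun_scaleE /=; case k_i: (aval k.1 i) => [|e].
  by rewrite subA_None // ffunE mulr0.
rewrite subA_Some k_i //= monoE [x]surjective_pairing xpair_eqE.
have [x1|] /= := eqVneq x.1; last by rewrite mulr0.
have lt_e : (e < pi i)%N by rewrite -k_i aval_le.
by move: ge_x; rewrite x1 (aval_setA k.1 (ltnW lt_e)) eqxx lt_e.
Qed.

Definition below u j := #|[set l in u | (l < j)%N]|.

Lemma below_setU1 u j : below (j |: u) j = below u j.
Proof. by congr #|pred_of_set _|; apply/setP => l; rewrite !inE; case: eqP => [->|] //;
  rewrite ltnn !andbF. Qed.

Lemma dO_odd j f x : dO (inr j) f x =
  if j \in x.2 then 0 else (-1) ^+ below x.2 j * f (x.1, j |: x.2).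
Proof.
rewrite /dO sum_ffunE; case: ifP => [jx|njx].
  rewrite big1 // => k _; rewrite ffun_scaleE /=; case: ifP => _; last by rewrite ffunE mulr0.
  rewrite ffun_scaleE monoE; case: eqP => [xE|]; last by rewrite !mulr0.
  by move: jx; rewrite xE /= !inE eqxx.
rewrite (sum_unique (y := (x.1, j |: x.2))) => [|k neq_k].
  rewrite ffun_scaleE /= setU11 -/(below (j |: x.2) j) below_setU1 setU1K ?njx //.
  by rewrite ffun_scaleE -surjective_pairing monoE eqxx mulr1 mulrC.
rewrite ffun_scaleE /=; case: ifP => jk; last by rewrite ffunE mulr0.
rewrite ffun_scaleE monoE; case: eqP => [xE|]; last by rewrite !mulr0.
by case/eqP: neq_k; rewrite xE /= setD1K // -surjective_pairing.
Qed.

End Coordinates.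

(** * Supercommutativity, the Leibniz rule and supercommuting derivations *)

Section LeibnizRule.
Variables (F : fieldType) (r n : nat) (pi : 'I_(r.*2) -> nat).
Local Notation m := (r.*2).
Local Notation Mon := (Mon n pi).
Local Notation Alpha := (Alpha pi).
Local Notation Ix := (Ix r n).
Local Notation Oalg := {ffun Mon -> F^o}.
Local Notation Wder := {ffun Ix -> Oalg}.
Implicit Types (a b c : Alpha) (i : 'I_m) (u v w : {set 'I_n}) (j : 'I_n).
Implicit Types (f g h : Oalg) (k l x : Mon) (q : bool).
(** Reduces identities between products to monomials; taking [idfun] for one map covers products in
    which a single factor is differentiated. *)
Lemma mulO_lin2 (L1 L2 : {linear Oalg -> Oalg}) f g :
  mulO (L1 f) (L2 g) =
  \sum_k \sum_l (f k * g l) *: mulO (L1 (mono F k)) (L2 (mono F l)).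
Proof.
rewrite {1}(mono_sum f) linear_sum -[LHS]/(mulOr (L2 g) _) linear_sum.
apply: eq_bigr => k _; rewrite /= linearZ /= linearZ /=.
rewrite /mulOr {1}(mono_sum g) (linear_sum L2) (linear_sum (mulO _)) scaler_sumr.
apply: eq_bigr => l _.
by rewrite /= linearZ /= linearZ /= scalerA.
Qed.

Definition homO q f := forall k, mon_par k != q -> f k = 0.

(** The contribution of one even variable to [coefA]. An even derivation alters only one such
    factor. *)
Definition facA (e d s : nat) : F := (e + d == s)%N%:R * 'C(s, e)%:R.

Lemma coefA_setl a b c i (e : nat) : (e <= pi i)%N ->
  coefA F (setA a i e) b c = facA e (aval b i) (aval c i) *
    \prod_(i0 | i0 != i) facA (aval a i0) (aval b i0) (aval c i0).
Proof.
move=> le_e; rewrite /coefA (bigD1 i) //= !aval_setA // eqxx; congr (_ * _).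
by apply: eq_bigr => i0 /negbTE neq; rewrite aval_setA // neq.
Qed.

Lemma coefA_setr a b c i (e : nat) : (e <= pi i)%N ->
  coefA F a (setA b i e) c = facA (aval a i) e (aval c i) *
    \prod_(i0 | i0 != i) facA (aval a i0) (aval b i0) (aval c i0).
Proof.
move=> le_e; rewrite /coefA (bigD1 i) //= !aval_setA // eqxx; congr (_ * _).
by apply: eq_bigr => i0 /negbTE neq; rewrite aval_setA // neq.
Qed.

Lemma coefA_setm a b c i (e : nat) : (e <= pi i)%N ->
  coefA F a b (setA c i e) = facA (aval a i) (aval b i) e *
    \prod_(i0 | i0 != i) facA (aval a i0) (aval b i0) (aval c i0).
Proof.
move=> le_e; rewrite /coefA (bigD1 i) //= !aval_setA // eqxx; congr (_ * _).
by apply: eq_bigr => i0 /negbTE neq; rewrite aval_setA // neq.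
Qed.

Lemma coefA_comm a b c : coefA F a b c = coefA F b a c.
Proof.
apply: eq_bigr => i _; rewrite [(aval b i + _)%N]addnC.
case: eqP => [<-|]; last by rewrite !mul0r.
by rewrite -bin_sub ?leq_addr // addKn.
Qed.

Definition above u j := #|[set l in u | (j < l)%N]|.

Lemma inv_suml u v : inv u v = \sum_(a in u) below v a.
Proof.
rewrite /inv -sum1_card; under [RHS]eq_bigr do rewrite /below -sum1_card.
by rewrite pair_big_dep /=; apply: eq_bigl => -[a b]; rewrite !inE /= andbA.
Qed.

Lemma inv_sumr u v : inv u v = \sum_(b in v) above u b.
Proof.
rewrite inv_suml /below /above; under eq_bigr do rewrite -sum1_card.
rewrite (exchange_big_dep (mem v)) => [|a b _]; last by rewrite inE => /andP[].
apply: eq_bigr => b bv; rewrite -sum1_card.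
by apply: eq_bigl => a; rewrite !inE [b \in v]bv.
Qed.

Lemma inv_setD1l u v j : j \in u -> inv u v = (below v j + inv (u :\ j) v)%N.
Proof. by move=> ju; rewrite !inv_suml (big_setD1 j). Qed.

Lemma inv_setD1r u v j : j \in v -> inv u v = (above u j + inv u (v :\ j))%N.
Proof. by move=> jv; rewrite !inv_sumr (big_setD1 j). Qed.

Lemma card_below_above u j : #|u| = (below u j + (j \in u) + above u j)%N.
Proof.
rewrite /below /above -addnA -(cardsID [set l : 'I_n | (l < j)%N] u); congr (_ + _)%N.
  by apply: eq_card => l; rewrite !inE.
rewrite (cardsD1 j) !inE ltnn /=; congr (_ + _)%N.
by apply: eq_card => l; rewrite !inE -val_eqE /=; case: ltngtP; rewrite ?andbF ?andbT.
Qed.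

Lemma belowU u v j : [disjoint u & v] -> below (u :|: v) j = (below u j + below v j)%N.
Proof.
move=> duv; rewrite /below -cardsUI.
rewrite (_ : [set l in u | (l < j)%N] :&: [set l in v | (l < j)%N] = set0) ?cards0 ?addn0.
  by apply: eq_card => l; rewrite !inE andb_orl.
apply/setP => l; rewrite !inE; case lu: (l \in u) => //=.
by rewrite (disjointFr duv lu) andbF.
Qed.

Lemma belowD1 u j : below (u :\ j) j = below u j.
Proof. by apply: eq_card => l; rewrite !inE -val_eqE /=; case: ltngtP; rewrite ?andbF ?andbT. Qed.

Lemma aboveD1 u j : above (u :\ j) j = above u j.
Proof. by apply: eq_card => l; rewrite !inE -val_eqE /=; case: ltngtP; rewrite ?andbF ?andbT. Qed.

(** For disjoint sets each pair of indices is an inversion in exactly one of the two orders. *)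
Lemma inv_swap u v : [disjoint u & v] -> (inv u v + inv v u = #|u| * #|v|)%N.
Proof.
move=> duv; rewrite inv_suml inv_sumr -big_split /= -sum_nat_const.
apply: eq_bigr => a au; rewrite (card_below_above v a).
by rewrite (disjointFr duv au) addn0.
Qed.

Lemma coefB_comm u v w : coefB F u v w = (-1) ^+ (odd #|u| && odd #|v|) * coefB F v u w.
Proof.
rewrite /coefB disjoint_sym (setUC v); case: andP => [[dvu _]|_]; rewrite ?mul0r ?mulr0 //.
rewrite !mul1r -exprD -signr_odd -[RHS]signr_odd.
have /(congr1 odd) := inv_swap dvu; rewrite oddM !oddD oddb andbC => <-.
by case: (odd (inv u v)); case: (odd (inv v u)).
Qed.

(** The odd Leibniz rule on structure constants. If [j] lies in exactly one of [u] and [v], moving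
    x_j to the front matches one term with the left side; if it lies in both, the product is 0 and
    the two right-hand terms must cancel. *)
Lemma coefB_leibniz u v w j :
  (if j \in w then 0 else (-1) ^+ below w j * coefB F u v (j |: w)) =
  (if j \in u then (-1) ^+ below u j * coefB F (u :\ j) v w else 0) +
  (-1) ^+ #|u| * (if j \in v then (-1) ^+ below v j * coefB F u (v :\ j) w else 0).
Proof.
have sgn N1 N2 : odd N1 = odd N2 -> (-1) ^+ N1 = (-1) ^+ N2 :> F.
  by move=> eqN; rewrite -signr_odd eqN signr_odd.
case ju: (j \in u); case jv: (j \in v); rewrite ?mulr0 ?addr0 ?add0r.
- have -> : coefB F u v (j |: w) = 0.
    by rewrite /coefB (_ : [disjoint u & v] = false) ?mul0r // -setI_eq0;
      apply/eqP => /setP/(_ j); rewrite !inE ju jv.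
  rewrite mulr0 if_same /coefB.
  rewrite (_ : [disjoint u :\ j & v] = [disjoint u & v :\ j]); last first.
    by rewrite -!setI_eq0; congr (_ == set0); apply/setP => l; rewrite !inE; case: (l == j);
      rewrite /= ?andbF.
  rewrite (_ : u :\ j :|: v = u :|: v :\ j); last first.
    by apply/setP => l; rewrite !inE; case: eqP => [->|]; rewrite ?ju ?jv.
  case: (_ && _); rewrite ?mul0r ?mulr0 ?addr0 //=.
  rewrite !mul1r -!exprD.
  have := card_below_above u j; rewrite ju => cu.
  have := inv_setD1l v ju; have := inv_setD1r u jv => e1 e2.
  (* Both terms have the same union of indices, and the counts of inversions show that their signs
     are opposite. *)
  rewrite [X in _ + X](_ : _ = - (-1) ^+ (below u j + inv (u :\ j) v)) ?subrr //.
  rewrite -[RHS]mulN1r -exprS; apply: sgn; move: cu e1 e2.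
  move: #|u| (below u j) (above u j) (below v j) (inv u v).
  by move: (inv u (v :\ j)) (inv (u :\ j) v) => *; lia.
- rewrite /coefB; case jw: (j \in w).
    by rewrite (_ : (_ :|: _ == w) = false) ?andbF ?mul0r ?mulr0 //; apply/eqP => /setP/(_ j);
      rewrite !inE eqxx jv jw.
  rewrite (_ : [disjoint u :\ j & v] = [disjoint u & v]); last first.
    by rewrite -!setI_eq0; congr (_ == set0); apply/setP => l; rewrite !inE;
      case: eqP => [->|] //; rewrite jv !andbF.
  rewrite (_ : (u :\ j :|: v == w) = (u :|: v == j |: w)); last first.
    apply/eqP/eqP => /setP eqw; apply/setP => l; move: (eqw l); rewrite !inE.
      by case: eqP => [->|] //; rewrite ju.
    by case: eqP => [->|] //; rewrite jv jw.
  case: andP => [[duv /eqP uvw]|_]; rewrite ?mul0r ?mulr0 ?addr0 //=.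
  rewrite !mul1r -!exprD; apply: sgn; have := inv_setD1l v ju.
  rewrite -(below_setU1 w) -uvw belowU //.
  by move: (below u j) (below v j) (inv u v) (inv _ v) => *; lia.
- rewrite /coefB; case jw: (j \in w).
    by rewrite (_ : (_ :|: _ == w) = false) ?andbF ?mul0r ?mulr0 //; apply/eqP => /setP/(_ j);
      rewrite !inE eqxx ju jw.
  rewrite (_ : [disjoint u & v :\ j] = [disjoint u & v]); last first.
    by rewrite -!setI_eq0; congr (_ == set0); apply/setP => l; rewrite !inE;
      case: eqP => [->|] //; rewrite ju.
  rewrite (_ : (u :|: v :\ j == w) = (u :|: v == j |: w)); last first.
    apply/eqP/eqP => /setP eqw; apply/setP => l; move: (eqw l); rewrite !inE.
      by case: eqP => [->|] //; rewrite jv orbT.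
    by case: eqP => [->|] //; rewrite ju jw.
  case: andP => [[duv /eqP uvw]|_]; rewrite ?mul0r ?mulr0 ?addr0 //=.
  rewrite !mul1r -!exprD; apply: sgn; have := inv_setD1r u jv.
  have := card_below_above u j; rewrite ju.
  rewrite -(below_setU1 w) -uvw belowU //.
  by move: (below u j) (below v j) (above u j) (inv u v) (inv u _) #|u| => *; lia.
- rewrite /coefB; case: ifP => // _; rewrite (_ : (_ :|: _ == _) = false) ?andbF ?mul0r ?mulr0 //.
  by apply/eqP => /setP/(_ j); rewrite !inE eqxx ju jv.
Qed.

Lemma homO_neq0 q f k : homO q f -> f k != 0 -> mon_par k = q.
Proof. by move=> fq; apply: contra_neq_eq => /fq. Qed.

(** Lets terms be compared only where their coefficient is nonzero, which is where homogeneity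
    determines the parity of the monomial. *)
Lemma eq_scale (V : lmodType F) (c : F) (A B : V) : (c != 0 -> A = B) -> c *: A = c *: B.
Proof. by have [->|_ ->] := eqVneq c 0; rewrite // (scale0r A) (scale0r B). Qed.

Lemma monmul_comm k l : monmul F k l = (-1) ^+ (mon_par k && mon_par l) *: monmul F l k.
Proof.
apply/ffunP => x.
apply: etrans (monmulE F k l x) (etrans _ (esym (ffun_scaleE _ _ _))).
apply: etrans (congr1 _ (esym (monmulE F l k x))).
by rewrite coefA_comm coefB_comm mulrCA.
Qed.

Lemma mulO_supercomm q1 q2 f g : homO q1 f -> homO q2 g ->
  mulO f g = (-1) ^+ (q1 && q2) *: mulO g f.
Proof.
move=> fq gq; rewrite (mulOsum g) exchange_big mulOsum scaler_sumr.
apply: eq_bigr => k _; rewrite scaler_sumr; apply: eq_bigr => l _.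
rewrite [g l * f k]mulrC scalerA [_ * (f k * _)]mulrC -[RHS]scalerA.
apply: eq_scale.
rewrite mulf_eq0 negb_or => /andP[/(homO_neq0 fq) <- /(homO_neq0 gq) <-].
by rewrite !mulO_mono monmul_comm.
Qed.

(* For [pi i = p ^ t i - 1] these are the ['C(p ^ t i, e)]; their vanishing is what
   makes [d_i] a derivation where the product x^(a) x^(b) is truncated to 0. *)
Hypothesis binp : forall i (e : nat), (0 < e <= pi i)%N -> 'C((pi i).+1, e)%:R = 0 :> F.

(** This is Pascal's rule once the cut on the left is removed. At [s = pi i], [a + b = (pi i).+1]
    with both summands at most [pi i] forces [0 < a], so [binp] makes the untruncated term vanish as
    well. *)
Lemma facA_leibniz i (a b s : nat) : (a <= pi i)%N -> (b <= pi i)%N -> (s <= pi i)%N ->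
  (if (s < pi i)%N then facA a b s.+1 else 0) =
  (if (0 < a)%N then facA a.-1 b s else 0) + (if (0 < b)%N then facA a b.-1 s else 0).
Proof.
move=> le_a le_b le_s; transitivity (facA a b s.+1).
  case: ltngtP le_s => // sE _; rewrite sE /facA.
  case: eqP => [abE|_]; last by rewrite mul0r.
  by rewrite binp ?mulr0 //; lia.
rewrite /facA; case: a le_a => [|a] le_a /=.
  rewrite add0r !add0n !bin0; case: b le_b => [|b] //= _.
  by rewrite mul0r.
rewrite addSn eqSS binS natrD mulrDr addrC; congr (_ + _).
case: b le_b => [|b] le_b /=; last by rewrite addnS.
by rewrite addn0; case: eqP => [->|]; rewrite ?mul0r // bin_small ?mulr0.
Qed.

Lemma mul0O g : mulO 0 g = 0 :> Oalg.
Proof. exact: (linear0 (mulOr g)). Qed.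

Lemma leibniz_mono (s : Ix) k l :
  dO s (mulO (mono F k) (mono F l)) =
  mulO (dO s (mono F k)) (mono F l) +
  (-1) ^+ (ipar s && mon_par k) *: mulO (mono F k) (dO s (mono F l)).
Proof.
apply/ffunP => x; rewrite ffunE ffun_scaleE !dO_mono mulO_mono.
case: s => [i|j] /=.
  rewrite mul1r dO_even monmulE /=.
  set P := \prod_(i0 | i0 != i) facA (aval k.1 i0) (aval l.1 i0) (aval x.1 i0).
  transitivity ((if (aval x.1 i < pi i)%N then facA (aval k.1 i) (aval l.1 i) (aval x.1 i).+1 else 0) * (P * coefB F k.2 l.2 x.2)).
    by case: ifP => [lt_x|]; rewrite ?mul0r // coefA_setm // mulrA.
  rewrite facA_leibniz ?aval_le // mulrDl; congr (_ + _).
    case: posnP => [k0|k_gt0]; first by rewrite subA_None // mul0O ffunE mul0r.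
    rewrite subA_Some // mulO_mono monmulE coefA_setl ?mulrA //.
    by rewrite (leq_trans (leq_pred _)) ?aval_le.
  case: posnP => [l0|l_gt0]; first by rewrite subA_None // linear0 ffunE mul0r.
  rewrite subA_Some // mulO_mono monmulE coefA_setr ?mulrA //.
  by rewrite (leq_trans (leq_pred _)) ?aval_le.
rewrite dO_odd monmulE /= -signr_odd mulrA [_ * coefA F _ _ _]mulrC -mulrA.
transitivity (coefA F k.1 l.1 x.1 * (if j \in x.2 then 0 else (-1) ^+ below x.2 j * coefB F k.2 l.2 (j |: x.2))).
  by case: ifP => _; rewrite ?mulr0 ?signr_odd.
rewrite coefB_leibniz mulrDr; congr (_ + _).
  case: ifP => _; last by rewrite mulr0 mul0O ffunE.
  rewrite -[mulO (_ *: _) _]/(mulOr _ _) linearZ /= ffun_scaleE /mulOr mulO_mono monmulE.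
  by rewrite mulrCA.
rewrite /mon_par signr_odd mulrCA; congr (_ * _).
case: ifP => _; last by rewrite mulr0 linear0 ffunE.
by rewrite linearZ /= ffun_scaleE mulO_mono monmulE mulrCA.
Qed.

Lemma leibniz (s : Ix) q f g : homO q f ->
  dO s (mulO f g) = mulO (dO s f) g + (-1) ^+ (ipar s && q) *: mulO f (dO s g).
Proof.
move=> fq; rewrite mulOsum linear_sum.
rewrite (mulO_lin2 (dO s) idfun f g : mulO (dO s f) g = _).
rewrite (mulO_lin2 idfun (dO s) f g : mulO f (dO s g) = _).
rewrite scaler_sumr -big_split; apply: eq_bigr => k _ /=.
rewrite scaler_sumr linear_sum -big_split; apply: eq_bigr => l _ /=.
rewrite linearZ /= [X in _ + X]scalerA [_ * (f k * _)]mulrC -[X in _ + X]scalerA -scalerDr.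
apply: eq_scale; rewrite mulf_eq0 negb_or => /andP[/(homO_neq0 fq) <- _].
exact: leibniz_mono.
Qed.

Lemma dO_even_odd i j f x : dO (inl i) (dO (inr j) f) x = dO (inr j) (dO (inl i) f) x.
Proof.
rewrite [LHS]dO_even [RHS]dO_odd; case: ifP => lt_x; case: ifP => jx.
- by rewrite [LHS]dO_odd /= jx.
- by rewrite [LHS]dO_odd /= jx dO_even /= lt_x.
- by [].
- by rewrite dO_even /= lt_x mulr0.
Qed.

Lemma dO_even_even i i' f x : dO (inl i) (dO (inl i') f) x = dO (inl i') (dO (inl i) f) x.
Proof.
have [->//|/negbTE neq] := eqVneq i i'; have neq' : (i' == i) = false by rewrite eq_sym.
rewrite [LHS]dO_even [RHS]dO_even.
have [lt_i|ge_i] := ltnP (aval x.1 i) (pi i); have [lt_i'|ge_i'] := ltnP (aval x.1 i') (pi i').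
- rewrite [LHS]dO_even [RHS]dO_even /= (aval_setA _ lt_i) (aval_setA _ lt_i') neq neq' lt_i lt_i'.
  suff -> : setA (setA x.1 i (aval x.1 i).+1) i' (aval x.1 i').+1 =
    setA (setA x.1 i' (aval x.1 i').+1) i (aval x.1 i).+1 by [].
  apply: aval_inj => i0.
  apply: etrans (aval_setA _ lt_i' i0) (etrans _ (esym (aval_setA _ lt_i i0))).
  rewrite (aval_setA _ lt_i) (aval_setA _ lt_i').
  by have [->|//] := eqVneq i0 i; rewrite neq.
- by rewrite dO_even /= (aval_setA _ lt_i) neq' ltnNge ge_i'.
- by rewrite dO_even /= (aval_setA _ lt_i') neq ltnNge ge_i.
- by [].
Qed.

Lemma below_setU1_notin w (l : 'I_n) j : l \notin w -> below (l |: w) j = ((l < j)%N + below w j)%N.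
Proof.
move=> lw; rewrite belowU ?disjoints1 //; congr (_ + _)%N; rewrite /below.
case lj: (l < j)%N.
  by rewrite (_ : [set _ in _ | _] = [set l]) ?cards1 //; apply/setP => z; rewrite !inE;
    case: eqP => [->|].
by apply/eqP; rewrite cards_eq0 -subset0; apply/subsetP => z; rewrite !inE => /andP[/eqP->];
  rewrite lj.
Qed.

Lemma dO_odd_sq j f : dO (inr j) (dO (inr j) f) = 0.
Proof.
apply/ffunP => x; rewrite [RHS]ffunE dO_odd; case: ifP => // _.
by rewrite dO_odd /= setU11 mulr0.
Qed.

Lemma dO_odd2 j j' f x : j != j' -> dO (inr j) (dO (inr j') f) x =
  if (j \in x.2) || (j' \in x.2) then 0
  else (-1) ^+ (below x.2 j + ((j < j')%N + below x.2 j')) * f (x.1, j' |: (j |: x.2)).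
Proof.
move=> neq; rewrite dO_odd; case jx: (j \in x.2) => //=.
rewrite dO_odd /= !inE eq_sym (negbTE neq) /=.
case: ifP; rewrite ?mulr0 //= => _.
by rewrite below_setU1_notin ?jx // mulrA -exprD.
Qed.

Lemma dO_odd_odd j j' f : dO (inr j) (dO (inr j') f) = - dO (inr j') (dO (inr j) f).
Proof.
have [->|neq] := eqVneq j j'; first by rewrite dO_odd_sq oppr0.
apply/ffunP => x; apply: etrans (dO_odd2 f x neq) _; rewrite ffunE.
have neq' : j' != j by rewrite eq_sym.
apply: etrans (congr1 -%R (esym (dO_odd2 f x neq'))).
rewrite orbC setUCA; case: ifP; rewrite ?oppr0 // => _.
rewrite -mulNr; congr (_ * _); rewrite -[RHS]mulN1r -exprS -signr_odd -[RHS]signr_odd.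
by congr (_ ^+ nat_of_bool _); move: neq; rewrite -val_eqE /=; lia.
Qed.

Lemma dO_supercomm (s s' : Ix) f :
  dO s (dO s' f) = (-1) ^+ (ipar s && ipar s') *: dO s' (dO s f).
Proof.
case: s s' => [i|j] [i'|j'].
- by apply: etrans _ (esym (scale1r _)); apply/ffunP => x; apply: dO_even_even.
- by apply: etrans _ (esym (scale1r _)); apply/ffunP => x; apply: dO_even_odd.
- by apply: etrans _ (esym (scale1r _)); apply/ffunP => x; apply/esym/dO_even_odd.
exact: etrans (dO_odd_odd _ _ _) (esym (scaleN1r _)).
Qed.

End LeibnizRule.

(** * Hamiltonian fields and the bracket of their Hamiltonians *)

Section HamiltonianBracket.
Variables (F : fieldType) (r n : nat) (pi : 'I_(r.*2) -> nat).
Local Notation m := (r.*2).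
Local Notation Mon := (Mon n pi).
Local Notation Alpha := (Alpha pi).
Local Notation Ix := (Ix r n).
Local Notation Oalg := {ffun Mon -> F^o}.
Local Notation Wder := {ffun Ix -> Oalg}.
Implicit Types (a b c : Alpha) (i : 'I_m) (u v w : {set 'I_n}) (j : 'I_n).
Implicit Types (f g h : Oalg) (k l x : Mon) (q : bool).
Hypothesis binp : forall i (e : nat), (0 < e <= pi i)%N -> 'C((pi i).+1, e)%:R = 0 :> F.
Implicit Types (s t : Ix) (X Y : Wder).

Lemma iprimeK : involutive (@iprime r n).
Proof.
have insub_val N (x0 : 'I_N) e : (e < N)%N -> insubd x0 e = e :> nat by rewrite val_insubd => ->.
case=> [i|j] /=; congr (_ _); apply: val_inj.
  have := ltn_ord i; have [lt_i|ge_i] := ltnP i r => ltm.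
    have kE : insubd i (i + r)%N = (i + r)%N :> nat by apply: insub_val; lia.
    by rewrite kE ltnNge leq_addl /= insub_val addnK.
  have kE : insubd i (i - r)%N = (i - r)%N :> nat by apply: insub_val; lia.
  rewrite kE (_ : i - r < r)%N ?subnK //= ?insub_val //; lia.
have ltn := ltn_ord j; have := odd_double_half n => nE.
have [lt_j|ge_j] := ltnP j n./2.
  have kE : insubd j (j + n./2)%N = (j + n./2)%N :> nat by apply: insub_val; lia.
  rewrite kE (_ : (j + n./2 < n./2)%N = false); last by lia.
  rewrite (_ : j + n./2 < n./2.*2)%N ?addnK //= ?insub_val //; lia.
have [lt_j2|ge_j2] := ltnP j n./2.*2; last by rewrite !ltnNge ge_j ge_j2.
have kE : insubd j (j - n./2)%N = (j - n./2)%N :> nat by apply: insub_val; lia.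
rewrite kE (_ : j - n./2 < n./2)%N ?subnK //= ?insub_val //; lia.
Qed.

Lemma ipar_iprime s : ipar (iprime s) = ipar s.
Proof. by case: s. Qed.

(** The form pairing [s] with [iprime s] is skew on even indices and symmetric on odd ones. *)
Lemma tau_iprime s : tau F (iprime s) = - (-1) ^+ ipar s * tau F s.
Proof.
case: s => [i|j]; last by rewrite /= expr1 opprK mulr1.
rewrite /= expr0 mulN1r; have [lt_i|ge_i] := ltnP i r; have ltm := ltn_ord i; rewrite val_insubd.
  have -> : (i + r < r.*2)%N by lia.
  by rewrite ifF //; lia.
have -> : (i - r < r.*2)%N by lia.
by rewrite ifT ?opprK //; lia.
Qed.

Lemma homO_mono k : homO (mon_par k) (mono F k).
Proof. by move=> l; rewrite monoE; case: (l =P k) => [->|//]; rewrite eqxx. Qed.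

Lemma homOD q f g : homO q f -> homO q g -> homO q (f + g).
Proof. by move=> fq gq k nk; rewrite ffunE fq // gq // addr0. Qed.

Lemma homOZ q (c : F) f : homO q f -> homO q (c *: f).
Proof. by move=> fq k nk; rewrite ffun_scaleE fq // mulr0. Qed.

Lemma homO_sum (T : finType) (P : pred T) q (G : T -> Oalg) :
  (forall z, P z -> homO q (G z)) -> homO q (\sum_(z | P z) G z).
Proof. by move=> Gq k nk; rewrite sum_ffunE big1 // => z /Gq ->. Qed.

Lemma homO_dO s q f : homO q f -> homO (q (+) ipar s) (dO s f).
Proof.
move=> fq [a u] nk; case: s nk => [i|j] /= nk.
  by rewrite dO_even; case: ifP => // _; rewrite fq //; move: nk; rewrite addbF.
rewrite dO_odd; case: ifP => //= ju; rewrite fq ?mulr0 //; move: nk.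
by rewrite /mon_par /= cardsU1 ju oddD; case: (q); case: (odd _).
Qed.

Lemma homO_mulO q1 q2 f g : homO q1 f -> homO q2 g -> homO (q1 (+) q2) (mulO f g).
Proof.
move=> fq gq x nx; rewrite mulOE big1 // => k _; rewrite big1 // => l _.
have [->|fk] := eqVneq (f k) 0; first by rewrite !mul0r.
have [->|gl] := eqVneq (g l) 0; first by rewrite mulr0 mul0r.
rewrite monmulE /coefB; case: andP => [[dkl /eqP kl]|]; last by rewrite mul0r !mulr0.
case/eqP: nx; rewrite -(homO_neq0 fq fk) -(homO_neq0 gq gl) /mon_par -kl.
by rewrite cardsU disjoint_setI0 // cards0 subn0 oddD.
Qed.

Lemma mulOZl (c : F) f g : mulO (c *: f) g = c *: mulO f g.
Proof. exact: (linearZ_LR (mulOr g)). Qed.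

Definition act X h : Oalg := \sum_s mulO (X s) (dO s h).

Lemma act_linr X : linear (act X : Oalg -> Oalg).
Proof.
move=> c f g; rewrite /act scaler_sumr -big_split; apply: eq_bigr => s _.
by rewrite !linearP.
Qed.

HB.instance Definition _ X := GRing.isLinear.Build F Oalg Oalg _ (act X) (act_linr X).

Definition evenW X := forall s k, wpar k s -> X s k = 0.

(** With one field even, the sign in [brE] is 1 on every pair of terms with nonzero coefficients, so
    the bracket is the componentwise commutator of the two actions. *)
Lemma brW_act X Y : evenW X \/ evenW Y ->
  brW X Y = [ffun t => act X (Y t) - act Y (X t)].
Proof.
move=> eXY; pose A k s l := mulO (mono F k) (dO s (mono F l)).
transitivity (\sum_s \sum_k \sum_t \sum_l (X s k * Y t l) *: (fdi (A k s l) t - fdi (A l t k) s)).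
  apply: eq_bigr => s _; apply: eq_bigr => k _; apply: eq_bigr => t _; apply: eq_bigr => l _.
  apply: eq_scale; rewrite mulf_eq0 negb_or => /andP[Xsk Ytl]; rewrite /brE.
  rewrite (_ : wpar k s && wpar l t = false) ?scale1r //; apply/negP => /andP[wk wl].
  by case: eXY => [eX|eY]; [move: Xsk; rewrite eX // eqxx|move: Ytl; rewrite eY // eqxx].
apply/ffunP => t; rewrite [RHS]ffunE sum_ffunE.
under eq_bigr do (rewrite sum_ffunE; under eq_bigr do (rewrite sum_ffunE;
  under eq_bigr do rewrite sum_ffunE)).
transitivity (\sum_s \sum_k \sum_t0 \sum_l ((if t == t0 then (X s k * Y t0 l) *: A k s l else 0) - (if t == s then (X s k * Y t0 l) *: A l t0 k else 0))).
  apply: eq_bigr => s _; apply: eq_bigr => k _; apply: eq_bigr => t0 _; apply: eq_bigr => l _.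
  by rewrite !ffunE; do 2 case: ifP; rewrite ?subr0 ?sub0r ?scaler0 ?scalerBr ?scalerN ?oppr0.
under eq_bigr do under eq_bigr do under eq_bigr do rewrite sumrB.
under eq_bigr do under eq_bigr do rewrite sumrB.
under eq_bigr do rewrite sumrB.
rewrite sumrB; congr (_ - _).
  rewrite /act; apply: eq_bigr => s _.
  rewrite (mulO_lin2 idfun (dO s) (X s) (Y t) : mulO (X s) (dO s (Y t)) = _).
  apply: eq_bigr => k _; rewrite (sum_unique (y := t)) => [|t0 /negbTE neq].
    by apply: eq_bigr => l _; rewrite eqxx.
  by rewrite big1 // => l _; rewrite eq_sym neq.
rewrite (sum_unique (y := t)) => [|s /negbTE neq]; last first.
  by do 3 (rewrite big1 // => ? _); rewrite eq_sym neq.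
rewrite exchange_big; apply: eq_bigr => t0 _; rewrite exchange_big.
rewrite (mulO_lin2 idfun (dO t0) (Y t0) (X t) : mulO (Y t0) (dO t0 (X t)) = _).
by apply: eq_bigr => l _; apply: eq_bigr => k _; rewrite eqxx [X t k * _]mulrC.
Qed.

(* [q] stands for the parity of [h]; as a parameter it makes [DHq q] linear. *)
Definition DHq q h : Wder :=
  [ffun s => (tau F (iprime s) * (-1) ^+ (ipar s && q)) *: dO (iprime s) h].

Lemma DHqE q h s : DHq q h (iprime s) = (tau F s * (-1) ^+ (ipar s && q)) *: dO s h.
Proof. by rewrite ffunE iprimeK ipar_iprime. Qed.

Lemma DHq_lin q : linear (DHq q : Oalg -> Wder).
Proof.
move=> c f g; apply/ffunP => s; rewrite !ffunE linearP scalerDr !scalerA.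
by rewrite [_ * c]mulrC.
Qed.

HB.instance Definition _ q := GRing.isLinear.Build F Oalg Wder _ (DHq q) (DHq_lin q).

Lemma DH_DHq k : DH F k = DHq (mon_par k) (mono F k).
Proof.
apply/ffunP => t; rewrite sum_ffunE (sum_unique (y := iprime t)) => [|s neq].
  by rewrite !ffunE iprimeK eqxx ipar_iprime.
rewrite !ffunE; case: eqP => [tE|_]; last by rewrite scaler0.
by rewrite tE iprimeK eqxx in neq.
Qed.

Lemma evenW_DHq h : homO false h -> evenW (DHq false h).
Proof.
move=> hq s k; rewrite /wpar => wk; rewrite ffunE ffun_scaleE (homO_dO hq) ?mulr0 //.
by rewrite ipar_iprime; move: wk; case: (mon_par k); case: ipar.
Qed.

(** The Poisson bracket for an even first argument: the sign depending on the parity of [f] is then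
    1 and is left out. *)
Definition pb f g : Oalg := \sum_s tau F s *: mulO (dO s f) (dO (iprime s) g).

Lemma pb_linr f : linear (pb f : Oalg -> Oalg).
Proof.
move=> c g h; rewrite /pb scaler_sumr -big_split; apply: eq_bigr => s _.
by rewrite linearP /= linearP /= scalerDr !scalerA [c * _]mulrC.
Qed.

HB.instance Definition _ f := GRing.isLinear.Build F Oalg Oalg _ (pb f) (pb_linr f).

Lemma act_DHq q g h :
  act (DHq q g) h = \sum_s (tau F s * (-1) ^+ (ipar s && q)) *: mulO (dO s g) (dO (iprime s) h).
Proof.
rewrite /act (reindex_inj (inv_inj iprimeK)); apply: eq_bigr => s _.
by rewrite DHqE mulOZl.
Qed.

Lemma act_DHq0 f h : act (DHq false f) h = pb f h.
Proof. by rewrite act_DHq; apply: eq_bigr => s _; rewrite andbF mulr1. Qed.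

(** Passing [d_s] over [d_t f] and commuting it with the derivative of [g] produce the same sign
    twice, so the second part is again a bracket without sign. *)
Lemma dO_pb s f g : homO false f ->
  dO s (pb f g) = \sum_t tau F t *: mulO (dO s (dO t f)) (dO (iprime t) g) + pb f (dO s g).
Proof.
move=> fq; rewrite /pb linear_sum -big_split; apply: eq_bigr => t _.
rewrite [LHS]linearZ /= -scalerDr; congr (_ *: _).
rewrite (leibniz binp s _ (homO_dO (s := t) fq)); congr (_ + _).
by rewrite (dO_supercomm (iprime t)) [RHS]linearZ /= ipar_iprime andbC.
Qed.

Lemma brW_DHq q f g : homO false f -> homO q g ->
  brW (DHq false f) (DHq q g) = DHq q (pb f g).
Proof.
move=> fq gq; rewrite brW_act; last by left; apply: evenW_DHq.
apply/ffunP => t; rewrite -(iprimeK t) [LHS]ffunE; move: (iprime t) => s.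
rewrite !DHqE act_DHq0 linearZ /= dO_pb // scalerDr addrC; congr (_ + _).
(* The action of the second field on the first must equal, up to sign, the terms in which [d_s]
   falls on [d_t f]. Reindexing by the involution and exchanging the factors aligns the sums; only
   signs remain to be compared. *)
rewrite andbF mulr1 linearZ /= act_DHq (reindex_inj (inv_inj iprimeK)) !scaler_sumr -sumrN.
apply: eq_bigr => t0 _; rewrite iprimeK.
rewrite (mulO_supercomm (homO_dO (s := iprime t0) gq) (homO_dO (s := t0) (homO_dO (s := s) fq))).
rewrite (dO_supercomm t0 s) mulOZl !scalerA -scaleNr; congr (_ *: _).
rewrite tau_iprime !ipar_iprime; case: q (ipar s) (ipar t0) {gq} => [] [] [] /=;
  rewrite ?(expr0, expr1); ring.
Qed.

End HamiltonianBracket.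

(** * Brackets of even Hamiltonian fields land in J *)

Section DerivedAlgebra.
Variables (F : fieldType) (r n : nat) (pi : 'I_(r.*2) -> nat).
Local Notation m := (r.*2).
Local Notation Mon := (Mon n pi).
Local Notation Alpha := (Alpha pi).
Local Notation Ix := (Ix r n).
Local Notation Oalg := {ffun Mon -> F^o}.
Local Notation Wder := {ffun Ix -> Oalg}.
Implicit Types (a b c : Alpha) (i : 'I_m) (u v w : {set 'I_n}) (j : 'I_n).
Implicit Types (f g h : Oalg) (k l x : Mon) (q : bool).
Hypothesis binp : forall i (e : nat), (0 < e <= pi i)%N -> 'C((pi i).+1, e)%:R = 0 :> F.
Hypothesis two_neq0 : 2%:R != 0 :> F.
Implicit Types (s t : Ix) (X Y : Wder).

(** The involution [iprime] negates the sum: [tau] contributes -(-1)^|s| and exchanging the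
    derivations contributes (-1)^|s|. The two parities are kept apart because later the even and odd
    halves of a bracket vanish at a given monomial for different reasons. *)
Lemma sum_tau_dO_dO q g : \sum_(s : Ix | ipar s == q) tau F s *: dO s (dO (iprime s) g) = 0.
Proof.
set S := LHS; suff: S = - S.
  move/eqP; rewrite -subr_eq0 opprK -mulr2n -scaler_nat scaler_eq0 (negbTE two_neq0) /=.
  by move/eqP.
rewrite {1}/S (reindex_inj (inv_inj (@iprimeK r n))) -sumrN.
apply: eq_big => s; rewrite ipar_iprime // => _.
rewrite iprimeK dO_supercomm ipar_iprime andbb scalerA -scaleNr tau_iprime; congr (_ *: _).
by rewrite !mulNr mulrAC -expr2 sqrr_sign mul1r.
Qed.

(* [sum_s tau_s d_s d_s' = 0], so the bracket is a divergence. *)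
Lemma pb_divergence q f g : homO false f ->
  \sum_(s : Ix | ipar s == q) tau F s *: mulO (dO s f) (dO (iprime s) g) =
  \sum_(s : Ix | ipar s == q) tau F s *: dO s (mulO f (dO (iprime s) g)).
Proof.
move=> fq.
have E : \sum_(s : Ix | ipar s == q) tau F s *: mulO f (dO s (dO (iprime s) g)) = 0.
  transitivity (mulO f (\sum_(s : Ix | ipar s == q) tau F s *: dO s (dO (iprime s) g))).
    by rewrite (linear_sum (mulO f)); apply: eq_bigr => s _; rewrite [RHS]linearZ.
  by rewrite sum_tau_dO_dO linear0.
apply: etrans (esym (addr0 _)) (etrans (congr1 _ (esym E)) _).
rewrite -big_split; apply: eq_bigr => s _ /=.
by rewrite (leibniz binp s _ fq) andbF scale1r scalerDr.
Qed.

Lemma pb_split f g : pb f g =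
  \sum_(s : Ix | ipar s == false) tau F s *: mulO (dO s f) (dO (iprime s) g) +
  \sum_(s : Ix | ipar s == true) tau F s *: mulO (dO s f) (dO (iprime s) g).
Proof.
rewrite /pb (bigID (fun s => ipar s == false)) /=; congr (_ + _).
by apply: eq_bigl => s; case: ipar.
Qed.

Lemma homO_pb q f g : homO false f -> homO q g -> homO q (pb f g).
Proof.
move=> fq gq; apply: homO_sum => s _; apply: homOZ.
have := homO_mulO (homO_dO (s := s) fq) (homO_dO (s := iprime s) gq).
by rewrite ipar_iprime addFb addbCA addbb addbF.
Qed.

Lemma pb_even_top u f g : homO false f ->
  (\sum_(s : Ix | ipar s == false) tau F s *: mulO (dO s f) (dO (iprime s) g)) (piA pi, u) = 0.
Proof.
move=> fq; rewrite (pb_divergence _ _ fq) sum_ffunE big1 // => -[i|j] //= _.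
by rewrite ffun_scaleE dO_even /= aval_piA ltnn mulr0.
Qed.

Lemma mulO_set0 f g a : homO true f -> mulO f g (a, set0) = 0.
Proof.
move=> fq; rewrite mulOE big1 // => k _; rewrite big1 // => l _.
rewrite monmulE /coefB; case: andP => [[_ /eqP]|_]; last by rewrite mul0r !mulr0.
move/eqP; rewrite setU_eq0 => /andP[/eqP k0 _].
by rewrite fq ?mul0r // /mon_par k0 cards0.
Qed.

(** The even half is a divergence and misses the maximal exponent; in the odd half each product has
    an odd left factor, so no term is free of odd variables. *)
Lemma pb_monPi f g : homO false f -> homO false g -> pb f g (monPi n pi) = 0.
Proof.
move=> fq gq; rewrite pb_split ffunE pb_even_top // add0r sum_ffunE big1 // => -[i|j] //= _.
by rewrite ffun_scaleE (mulO_set0 _ _ (homO_dO (s := inr j) fq)) mulr0.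
Qed.

(** Both halves are divergences, and the image of the odd [d_j] contains no monomial divisible by
    x_j. *)
Lemma pb_monPiOmega f g : homO false f -> pb f g (monPiOmega n pi) = 0.
Proof.
move=> fq; rewrite pb_split ffunE pb_even_top // add0r pb_divergence // sum_ffunE big1 // => -[i|j] //= _.
by rewrite ffun_scaleE dO_odd inE mulr0.
Qed.

(** Linearity of [DHq false] turns a combination of fields into the field of one Hamiltonian, whose
    support then expresses membership. *)
Lemma inDHspanP (P : pred Mon) X : (forall k, P k -> mon_par k = false) ->
  inDHspan P X <-> exists2 f : Oalg, (forall k, ~~ P k -> f k = 0) & X = DHq false f.
Proof.
move=> Peven; split=> [[c ->]|[f f0 ->]].
  exists (\sum_(k | P k) c k *: mono F k) => [k Pk|].
    rewrite sum_ffunE big1 // => l Pl; rewrite ffun_scaleE monoE.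
    by case: eqP Pk => [->|]; rewrite ?Pl ?mulr0.
  rewrite linear_sum; apply: eq_bigr => k Pk.
  by rewrite linearZ DH_DHq Peven.
exists f; rewrite [in LHS](mono_sum f) linear_sum (bigID P) /= [X in _ + X]big1 ?addr0.
  by apply: eq_bigr => k Pk; rewrite linearZ DH_DHq Peven.
by move=> k /f0 ->; rewrite scale0r linear0.
Qed.

Lemma inH0P X : inH0 X <-> exists f : Oalg,
  [/\ homO false f, f (monPiOmega n pi) = 0 & X = DHq false f].
Proof.
rewrite /inH0 inDHspanP => [|k /andP[/negbTE] //].
split=> [[f f0 ->]|[f [fq f0 ->]]]; exists f => //.
  split=> // [k kq|]; apply: f0; last by rewrite /H0idx eqxx andbF.
  by apply: contra kq => /andP[/negbTE kev _]; rewrite /mon_par kev.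
move=> k; rewrite negb_and !negbK => /orP[kodd|/eqP -> //].
by apply: fq; rewrite /mon_par kodd.
Qed.

Lemma inJP X : inJ X <-> exists f : Oalg,
  [/\ homO false f, f (monPiOmega n pi) = 0, f (monPi n pi) = 0 & X = DHq false f].
Proof.
rewrite /inJ inDHspanP => [|k /andP[/andP[/negbTE]] //].
split=> [[f f0 ->]|[f [fq f0 f1 ->]]]; exists f => //.
  split=> // [k kq| |]; apply: f0; rewrite /Jidx /H0idx ?eqxx ?andbF //.
  by apply: contra kq => /andP[/andP[/negbTE kev _] _]; rewrite /mon_par kev.
move=> k; have [->|n1] := eqVneq k (monPi n pi); first by [].
have [->|n2] := eqVneq k (monPiOmega n pi); first by [].
rewrite /Jidx /H0idx n1 n2 !andbT negbK => kodd.
by apply: fq; rewrite /mon_par kodd.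
Qed.

Lemma inJ_brW X Y : inH0 X -> inH0 Y -> inJ (brW X Y).
Proof.
move=> /inH0P[f [fq _ ->]] /inH0P[g [gq _ ->]]; apply/inJP; exists (pb f g).
by split; rewrite ?pb_monPiOmega ?pb_monPi ?brW_DHq //; apply: homO_pb.
Qed.

End DerivedAlgebra.

(** * Multiplication by exterior monomials *)

Section OddMonomials.
Variables (F : fieldType) (r n : nat) (pi : 'I_(r.*2) -> nat).
Local Notation m := (r.*2).
Local Notation Mon := (Mon n pi).
Local Notation Alpha := (Alpha pi).
Local Notation Ix := (Ix r n).
Local Notation Oalg := {ffun Mon -> F^o}.
Local Notation Wder := {ffun Ix -> Oalg}.
Implicit Types (a b c : Alpha) (i : 'I_m) (u v w : {set 'I_n}) (j : 'I_n).
Implicit Types (f g h : Oalg) (k l x : Mon) (q : bool).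
Implicit Types (s t : Ix) (X Y : Wder).

Definition xodd u : Oalg := mono F (zeroA pi, u).

Lemma coefA0 b c : coefA F (zeroA pi) b c = (b == c)%:R.
Proof.
have [->|neq] := eqVneq b c.
  by rewrite /coefA big1 // => i _; rewrite aval_zeroA eqxx bin0 mulr1.
have [i nle] : exists i, aval b i != aval c i.
  apply/existsP; rewrite -negb_forall; apply: contra neq => /forallP eq_bc.
  by apply/eqP/aval_inj => i; apply/eqP.
by rewrite /coefA (bigD1 i) //= aval_zeroA (negbTE nle) !mul0r.
Qed.

Lemma setUDK u w : u \subset w -> u :|: w :\: u = w.
Proof. by move/setIidPr => uw; rewrite -{1}uw setID. Qed.

Lemma disjoint_setD u w : [disjoint w :\: u & u].
Proof. by rewrite disjoints_subset setDE subsetIr. Qed.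

Lemma coefBE u v w : coefB F u v w = ((u \subset w) && (v == w :\: u))%:R * (-1) ^+ inv u v.
Proof.
rewrite /coefB; congr ((nat_of_bool _)%:R * _).
apply/andP/andP => [[duv /eqP <-]|[uw /eqP ->]]; split.
- exact: subsetUl.
- by rewrite setDUl setDv set0U (setDidPl _) // disjoint_sym.
- by rewrite disjoint_sym disjoint_setD.
by rewrite setUDK.
Qed.

Lemma mulO_xoddl v h a u : mulO (xodd v) h (a, u) =
  if v \subset u then (-1) ^+ inv v (u :\: v) * h (a, u :\: v) else 0.
Proof.
rewrite mulOE (sum_unique (y := (zeroA pi, v))) => [|k neq]; last first.
  by rewrite big1 // => l _; rewrite monoE (negbTE neq) !mul0r.
under eq_bigr do rewrite monoE eqxx mul1r monmulE /= coefA0 coefBE.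
case: ifP => vu /=; last by rewrite big1 // => l _; rewrite mul0r !mulr0.
rewrite (sum_unique (y := (a, u :\: v))) /= => [|[b v'] neq /=].
  by rewrite !eqxx !mul1r mulrC.
move: neq; rewrite xpair_eqE negb_and => /orP[] /negbTE ->; by rewrite !(mul0r, mulr0).
Qed.

Lemma mulO_xoddr v h a u : mulO h (xodd v) (a, u) =
  if v \subset u then (-1) ^+ inv (u :\: v) v * h (a, u :\: v) else 0.
Proof.
rewrite mulOE exchange_big (sum_unique (y := (zeroA pi, v))) => [|k neq]; last first.
  by rewrite big1 // => l _; rewrite monoE (negbTE neq) mulr0 mul0r.
have coefBr u' : coefB F u' v u = ((v \subset u) && (u' == u :\: v))%:R * (-1) ^+ inv u' v.
  rewrite /coefB; congr ((nat_of_bool _)%:R * _).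
  apply/andP/andP => [[duv /eqP <-]|[uw /eqP ->]]; split.
  - exact: subsetUr.
  - by rewrite setDUl setDv setU0 (setDidPl _).
  - exact: disjoint_setD.
  by rewrite setUC setUDK.
under eq_bigr do rewrite monoE eqxx mulr1 monmulE /= coefA_comm coefA0 coefBr.
case: ifP => vu /=; last by rewrite big1 // => l _; rewrite mul0r !mulr0.
rewrite (sum_unique (y := (a, u :\: v))) /= => [|[b v'] neq /=].
  by rewrite !eqxx !mul1r mulrC.
move: neq; rewrite xpair_eqE negb_and => /orP[] /negbTE ->; by rewrite !(mul0r, mulr0).
Qed.

Lemma mulO1l h : mulO (xodd set0) h = h.
Proof.
apply/ffunP => -[a u]; rewrite [LHS]mulO_xoddl sub0set setD0 inv_suml.
by rewrite big_set0 mul1r.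
Qed.

Lemma mulO1r h : mulO h (xodd set0) = h.
Proof.
apply/ffunP => -[a u]; rewrite [LHS]mulO_xoddr sub0set setD0 inv_sumr.
by rewrite big_set0 mul1r.
Qed.

Lemma mulO_x1l j h a u : mulO (xodd [set j]) h (a, u) =
  if j \in u then (-1) ^+ below u j * h (a, u :\ j) else 0.
Proof. by rewrite mulO_xoddl sub1set inv_suml big_set1 belowD1. Qed.

Lemma mulO_x1r j h a u : mulO h (xodd [set j]) (a, u) =
  if j \in u then (-1) ^+ above u j * h (a, u :\ j) else 0.
Proof. by rewrite mulO_xoddr sub1set inv_sumr big_set1 aboveD1. Qed.

(** The operator x_j d_j is diagonal on monomials; its eigenvalues are the weights used in the torus
    argument. *)
Lemma mulO_x_dO j h a u : mulO (xodd [set j]) (dO (inr j) h) (a, u) = (j \in u)%:R * h (a, u).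
Proof.
rewrite mulO_x1l; case: ifP => ju; last by rewrite mul0r.
by rewrite dO_odd /= !inE eqxx /= belowD1 setD1K // mulrA -expr2 sqrr_sign.
Qed.

Lemma dO_even_mono i k : dO (inl i) (mono F k) =
  if (0 < aval k.1 i)%N then mono F (setA k.1 i (aval k.1 i).-1, k.2) else 0.
Proof.
rewrite dO_mono /=; case: posnP => [k0|k_gt0]; first by rewrite subA_None.
by rewrite subA_Some.
Qed.

Lemma dO_even_xodd i u : dO (inl i) (xodd u) = 0.
Proof. by rewrite dO_even_mono aval_zeroA. Qed.

Lemma dO_odd_mono0 j a : dO (inr j) (mono F (a, set0)) = 0.
Proof. by rewrite dO_mono /= inE. Qed.

Lemma below_set1 j (l : 'I_n) : below [set l] j = (l < j)%N.
Proof.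
rewrite -(setU0 [set l]) below_setU1_notin ?inE // (_ : below set0 j = 0%N) ?addn0 //.
by apply/eqP; rewrite cards_eq0; apply/eqP/setP => z; rewrite !inE.
Qed.

Lemma dO_xodd1 j (l : 'I_n) : dO (inr l) (xodd [set j]) = if l == j then xodd set0 else 0.
Proof.
rewrite dO_mono /= inE; case: eqP => // ->; rewrite -/(below _ _) setDv.
by rewrite below_set1 ltnn scale1r.
Qed.

Lemma dO_xodd2 (j1 j2 l : 'I_n) : (j1 < j2)%N -> dO (inr l) (xodd [set j1; j2]) =
  (l == j1)%:R *: xodd [set j2] - (l == j2)%:R *: xodd [set j1].
Proof.
move=> lt12; have neq : (j1 == j2) = false by rewrite -val_eqE /= ltn_eqF.
have n1 : j1 \notin [set j2] by rewrite inE neq.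
have n2 : j2 \notin [set j1] by rewrite inE eq_sym neq.
rewrite dO_mono /= !inE -/(below _ _); have [->|neq1] := eqVneq l j1.
  rewrite neq scale0r subr0 below_setU1 below_set1 setU1K //.
  by rewrite ltnNge (ltnW lt12) scale1r.
have [->|neq2] := eqVneq l j2; last by rewrite !scale0r subr0.
rewrite scale0r sub0r setUC below_setU1 below_set1 lt12 setU1K //.
by rewrite expr1 scaleN1r scale1r.
Qed.

End OddMonomials.

(** * Equations satisfied by an odd field centralizing J *)

Section CentralizerOfJ.
Variables (F : fieldType) (r n : nat) (pi : 'I_(r.*2) -> nat).
Local Notation m := (r.*2).
Local Notation Mon := (Mon n pi).
Local Notation Alpha := (Alpha pi).
Local Notation Ix := (Ix r n).
Local Notation Oalg := {ffun Mon -> F^o}.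
Local Notation Wder := {ffun Ix -> Oalg}.
Implicit Types (a b c : Alpha) (i : 'I_m) (u v : {set 'I_n}) (j l : 'I_n).
Implicit Types (f g h : Oalg) (k x : Mon) (q : bool).
Hypothesis pi_gt2 : forall i, (2 < pi i)%N.
Hypothesis r_gt0 : (0 < r)%N.
Implicit Types (s t : Ix) (X Y : Wder).
Local Notation xodd := (@xodd F r n pi).

Definition jprime j : 'I_n :=
  if (j < n./2)%N then insubd j (j + n./2)%N
  else if (j < (n./2).*2)%N then insubd j (j - n./2)%N else j.

Lemma iprime_inr j : iprime (inr j : Ix) = inr (jprime j).
Proof. by []. Qed.

(** [iprime] acts on odd indices independently of [r], so its instance at 0 gives the claim. *)
Lemma jprimeK : involutive jprime.
Proof. by move=> j; have [] := @iprimeK 0 n (inr j). Qed.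

Lemma jprime_eqC j l : (jprime j == l) = (j == jprime l).
Proof. by rewrite -(inj_eq (inv_inj jprimeK)) jprimeK. Qed.

(** Both excluded monomials have maximal even exponents, so one smaller exponent is enough. *)
Lemma Jidx_lt k i : (aval k.1 i < pi i)%N -> ~~ odd #|k.2| -> Jidx k.
Proof.
move=> lt_k kev; have k1 : k.1 == piA pi = false.
  by apply/eqP => kE; move: lt_k; rewrite kE aval_piA ltnn.
by rewrite /Jidx /H0idx kev /= -!pair_eqE /= k1.
Qed.

Lemma pb_odd f h : (forall i, dO (inl i) h = 0) ->
  pb f h = \sum_j mulO (dO (inr j) f) (dO (inr (jprime j)) h).
Proof.
move=> h0; rewrite /pb big_sumType /= big1 ?add0r => [|i _]; last by rewrite h0 linear0 scaler0.
by apply: eq_bigr => j _; rewrite scale1r.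
Qed.

Lemma sum_delta (T : finType) (V : lmodType F) (G : T -> V) (y : T) :
  \sum_z (z == y)%:R *: G z = G y.
Proof.
rewrite (sum_unique (y := y)) => [|z /negbTE ->]; last by rewrite scale0r.
by rewrite eqxx scale1r.
Qed.

Lemma act_xodd2 X (j1 j2 : 'I_n) : (j1 < j2)%N ->
  act X (xodd [set j1; j2]) =
  mulO (X (inr j1)) (xodd [set j2]) - mulO (X (inr j2)) (xodd [set j1]).
Proof.
move=> lt12; rewrite /act big_sumType /= big1 ?add0r => [|i _];
  last by rewrite dO_even_xodd linear0.
transitivity (\sum_l ((l == j1)%:R *: mulO (X (inr l)) (xodd [set j2]) -
    (l == j2)%:R *: mulO (X (inr l)) (xodd [set j1]))).
  apply: eq_bigr => l _; rewrite dO_xodd2 // (linearB (mulO _)).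
  by congr (_ - _); apply: (linearZ_LR (mulO _)).
by rewrite sumrB; congr (_ - _); apply: sum_delta.
Qed.

Lemma act_xodd1 X j : act X (xodd [set j]) = X (inr j).
Proof.
rewrite /act big_sumType /= big1 ?add0r => [|i _]; last by rewrite dO_even_xodd linear0.
rewrite (sum_unique (y := j)) => [|l /negbTE neq]; last by rewrite dO_xodd1 neq linear0.
by rewrite dO_xodd1 eqxx mulO1r.
Qed.

Lemma act_xodd0 X : act X (xodd set0) = 0.
Proof.
rewrite /act big_sumType /= big1 ?add0r => [|i _]; last by rewrite dO_even_xodd linear0.
by rewrite big1 // => j _; rewrite dO_odd_mono0 linear0.
Qed.

Lemma scale_tau_eq0 s (V : lmodType F) (x : V) : tau F s *: x = 0 -> x = 0.
Proof.
move/eqP; rewrite scaler_eq0 => /orP[|/eqP //].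
by case: s => [i|j]; rewrite /tau; try case: ifP; rewrite ?oppr_eq0 oner_eq0.
Qed.

Lemma setA_idem a i (e e' : nat) : (e <= pi i)%N -> (e' <= pi i)%N ->
  setA (setA a i e) i e' = setA a i e'.
Proof.
move=> le_e le_e'; apply: aval_inj => i0.
apply: etrans (aval_setA _ le_e' i0) (etrans _ (esym (aval_setA _ le_e' i0))).
by rewrite (aval_setA _ le_e); case: eqP.
Qed.

Lemma setA_aval a i : setA a i (aval a i) = a.
Proof. by apply: aval_inj => i0; rewrite aval_setA ?aval_le //; case: eqP => [->|]. Qed.

Lemma dO_even_eps v i i0 : (1 <= pi i)%N ->
  dO (inl i0) (mono F (setA (zeroA pi) i 1, v)) = if i0 == i then xodd v else 0.
Proof.
move=> lt1; rewrite dO_even_mono /= (aval_setA _ lt1).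
have [->|_] := eqVneq i0 i; last by rewrite aval_zeroA.
by have := setA_aval (zeroA pi) i; rewrite aval_zeroA (setA_idem _ lt1 (leq0n _)) => ->.
Qed.

Lemma dO_even_eps1 v i : (1 <= pi i)%N -> dO (inl i) (mono F (setA (zeroA pi) i 1, v)) = xodd v.
Proof. by move=> lt1; rewrite dO_even_eps // eqxx. Qed.

Section Centralizer.
Variable w : Wder.
Hypothesis w1 : inW1 w.
Hypothesis cw : forall k, Jidx k -> brW (DH F k) w = 0.

(** The component of [D_H(x^k), w] = 0 at [iprime s]; each choice of [k] and [s] below tests [w]
    against one field of J. *)
Lemma centralizerE k s : Jidx k ->
  pb (mono F k) (w (iprime s)) = tau F s *: act w (dO s (mono F k)).
Proof.
move=> Jk; have kev : mon_par k = false by case/andP: Jk => /andP[/negbTE].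
have kq : homO false (mono F k) by rewrite -kev; apply: homO_mono.
have := cw Jk; rewrite DH_DHq kev brW_act; last by left; apply: evenW_DHq.
move/ffunP/(_ (iprime s)); rewrite [LHS]ffunE [RHS]ffunE => /eqP; rewrite subr_eq0 => /eqP.
by rewrite act_DHq0 DHqE andbF mulr1 linearZ.
Qed.

(** The Hamiltonian x_i', with i' the partner of [i], gives a nonzero constant multiple of [d_i].
    Bracketing with it differentiates every component of [w]. *)
Lemma centralizer_dO_even i t : dO (inl i) (w t) = 0.
Proof.
case def_i: (iprime (inl i : Ix)) => [i'|//].
have i'K : iprime (inl i' : Ix) = inl i by rewrite -def_i iprimeK.
pose a1 := setA (zeroA pi) i' 1; have lt1 : (1 <= pi i')%N := ltnW (ltnW (pi_gt2 i')).
have a1E : aval a1 =1 _ := aval_setA (zeroA pi) lt1.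
have Jk : Jidx ((a1, set0) : Mon).
  by apply: (@Jidx_lt _ i'); rewrite /= ?a1E ?eqxx ?cards0 // ltnW.
have down i0 := dO_even_eps set0 i0 lt1.
have := centralizerE (iprime t) Jk; rewrite iprimeK (_ : act w _ = 0) ?scaler0; last first.
  case: (iprime t) => [i0|j]; last by rewrite dO_odd_mono0 linear0.
  by rewrite down; case: ifP; rewrite ?act_xodd0 ?linear0.
rewrite /pb (sum_unique (y := inl i')) => [|[i0|j] neq].
- by rewrite down eqxx mulO1l i'K => /scale_tau_eq0.
- have [E|/negbTE neq_i] := eqVneq i0 i'; first by rewrite E eqxx in neq.
  by rewrite down neq_i mul0O scaler0.
by rewrite dO_odd_mono0 mul0O scaler0.
Qed.

(** If exponent [i] of [a] is positive, this coefficient of [w t] reappears in [d_i (w t)] with that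
    exponent lowered by one. *)
Lemma centralizer_zeroA t a u : a != zeroA pi -> w t (a, u) = 0.
Proof.
move=> neq; have [i a_i] : exists i, (0 < aval a i)%N.
  apply/existsP; apply: contraNT neq; rewrite negb_exists => /forallP a0.
  by apply/eqP/aval_inj => i; rewrite aval_zeroA; have := a0 i; rewrite -leqNgt leqn0 => /eqP.
have le_a : ((aval a i).-1 <= pi i)%N by rewrite (leq_trans (leq_pred _)) ?aval_le.
have := centralizer_dO_even i t => /ffunP/(_ (setA a i (aval a i).-1, u)).
rewrite dO_even ffunE /= (aval_setA a le_a) eqxx prednK // aval_le.
rewrite (_ : setA _ _ _ = a) //; apply: aval_inj => i0.
rewrite (aval_setA _ (aval_le a i)); case: eqP => [->|/eqP/negbTE neq0] //.
by rewrite (aval_setA a le_a) neq0.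
Qed.

(** D_H(x^(2 eps_i)) is a multiple of x_i d_i'. It kills the components of [w], which are free of
    even variables, so the bracket reduces to a multiple of [w (inl i)] in direction i'. *)
Lemma centralizer_even i : w (inl i) = 0.
Proof.
pose a2 := setA (zeroA pi) i 2; have lt2 : (2 <= pi i)%N := ltnW (pi_gt2 i).
have a2E : aval a2 =1 _ := aval_setA (zeroA pi) lt2.
have Jk : Jidx ((a2, set0) : Mon).
  by apply: (@Jidx_lt _ i); rewrite /= ?a2E ?eqxx ?cards0.
have := centralizerE (inl i) Jk.
rewrite pb_odd => [|i0]; last exact: centralizer_dO_even.
rewrite big1 => [|j _]; last by rewrite dO_odd_mono0 mul0O.
rewrite dO_even_mono /= a2E eqxx /=.
rewrite (setA_idem _ lt2 (ltnW lt2)).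
have -> : act w (mono F (setA (zeroA pi) i 1, set0)) = w (inl i).
  rewrite /act (sum_unique (y := inl i)) => [|[i0|j] neq]; last by rewrite dO_odd_mono0 linear0.
    by rewrite dO_even_eps ?eqxx ?mulO1r // ltnW.
  have [E|/negbTE neq_i] := eqVneq i0 i; first by rewrite E eqxx in neq.
  by rewrite dO_even_eps ?neq_i ?linear0 // ltnW.
by move/esym; apply: (@scale_tau_eq0 (inl i)).
Qed.

(** For the Hamiltonian x_i x_j x_l, the component of the bracket at the even index i' involves no
    derivative of [w], since [w] has no even components. What remains is [w] applied to x_j x_l. *)
Lemma centralizer_mulO j l : j != l ->
  mulO (w (inr j)) (xodd [set l]) = mulO (w (inr l)) (xodd [set j]).
Proof.
wlog lt_jl : j l / (j < l)%N.
  move=> IH neq; have [lt_jl|lt_lj|jl] := ltngtP j l; first exact: IH.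
    by apply/esym/IH; rewrite // eq_sym.
  by case/eqP: neq; apply: val_inj.
move=> neq; have m_gt0 : (0 < r.*2)%N by rewrite double_gt0.
pose i := Ordinal m_gt0; have lt1 : (1 < pi i)%N := ltnW (pi_gt2 i).
have Jk : Jidx ((setA (zeroA pi) i 1, [set j; l]) : Mon).
  by apply: (@Jidx_lt _ i); rewrite /= ?(aval_setA _ (ltnW lt1)) ?eqxx ?cards2 ?neq.
have := centralizerE (inl i) Jk;
  rewrite centralizer_even (linear0 (pb _)) (dO_even_eps1 _ (ltnW lt1)).
move/esym/scale_tau_eq0; rewrite (act_xodd2 w lt_jl) => /eqP.
by rewrite subr_eq0 => /eqP.
Qed.

(** The fields D_H(x_j1 x_j2) are the infinitesimal rotations of the odd variables. The case j2 =
    j1' is diagonal and gives the torus; other pairs relate different components of [w]. *)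
Lemma centralizer_rot (j1 j2 l : 'I_n) : (j1 < j2)%N ->
  mulO (xodd [set j2]) (dO (inr (jprime j1)) (w (inr (jprime l)))) -
  mulO (xodd [set j1]) (dO (inr (jprime j2)) (w (inr (jprime l)))) =
  (l == j1)%:R *: w (inr j2) - (l == j2)%:R *: w (inr j1).
Proof.
move=> lt12; have m_gt0 : (0 < r.*2)%N by rewrite double_gt0.
have neq : j1 != j2 by rewrite -val_eqE /= ltn_eqF.
have Jk : Jidx ((zeroA pi, [set j1; j2]) : Mon).
  apply: (@Jidx_lt _ (Ordinal m_gt0)); rewrite /= ?cards2 ?neq //.
  by rewrite aval_zeroA (leq_trans _ (pi_gt2 _)).
have := centralizerE (inr l) Jk; rewrite pb_odd => [|i]; last exact: centralizer_dO_even.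
rewrite scale1r iprime_inr dO_xodd2 // (linearB (act w)) /=.
rewrite !(linearZ_LR (act w)) /= !act_xodd1 => <-.
transitivity (\sum_l0 ((l0 == j1)%:R *: mulO (xodd [set j2]) (dO (inr (jprime l0)) (w (inr (jprime l)))) -
    (l0 == j2)%:R *: mulO (xodd [set j1]) (dO (inr (jprime l0)) (w (inr (jprime l)))))).
  rewrite sumrB; congr (_ - _); apply/esym.
    exact: (sum_delta (fun l0 => mulO (xodd [set j2]) (dO (inr (jprime l0)) (w (inr (jprime l)))))).
  exact: (sum_delta (fun l0 => mulO (xodd [set j1]) (dO (inr (jprime l0)) (w (inr (jprime l)))))).
apply: eq_bigr => l0 _; rewrite dO_xodd2 //.
rewrite -[RHS]/(mulOr _ _) (linearB (mulOr _)).
by congr (_ - _); apply/esym; apply: (linearZ_LR (mulOr _)).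
Qed.

Definition wcoef l u : F := w (inr l) (zeroA pi, u).

Lemma wcoef_even l u : odd #|u| -> wcoef l u = 0.
Proof. by move=> ou; apply: w1; rewrite /wpar /mon_par /= ou. Qed.

Lemma wcoef_rel j l u : j != l ->
  (if l \in u then (-1) ^+ above u l * wcoef j (u :\ l) else 0) =
  (if j \in u then (-1) ^+ above u j * wcoef l (u :\ j) else 0).
Proof.
move=> neq; have E := congr1 (fun f : Oalg => f (zeroA pi, u)) (centralizer_mulO neq).
exact: etrans (esym (mulO_x1r _ _ _ _)) (etrans E (mulO_x1r _ _ _ _)).
Qed.

(** The rotation in the plane of [j] and its partner compares weights: the left factor is the weight
    of x^u, and the right factor is the weight that the direction [d_l] requires. *)
Lemma wcoef_torus j l u : j != jprime j ->
  ((jprime j \in u)%:R - (j \in u)%:R) * wcoef l u =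
  ((l == jprime j)%:R - (l == j)%:R) * wcoef l u.
Proof.
wlog lt_j : j / (j < jprime j)%N.
  move=> IH neq; have [lt_j|lt_j|jj] := ltngtP j (jprime j); first exact: IH.
    have := IH (jprime j); rewrite jprimeK eq_sym => /(_ lt_j neq) E.
    by rewrite -opprB mulNr E -mulNr opprB.
  by case/eqP: neq; apply: val_inj.
move=> _; have E := congr1 (fun f : Oalg => f (zeroA pi, u)) (centralizer_rot (jprime l) lt_j).
move: E; rewrite !jprimeK !jprime_eqC jprimeK => E.
have e1 := mulO_x_dO (jprime j) (w (inr l)) (zeroA pi) u.
have e2 := mulO_x_dO j (w (inr l)) (zeroA pi) u.
rewrite !mulrBl -[LHS]/((jprime j \in u)%:R * w (inr l) (zeroA pi, u) -
  (j \in u)%:R * w (inr l) (zeroA pi, u)).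
rewrite -e1 -e2; apply: etrans (etrans E _); first by rewrite !ffunE.
rewrite !ffunE /=; congr (_ - _).
  by case: eqP => [->|]; rewrite ?scale0r ?mul0r // scale1r mul1r.
by case: eqP => [->|]; rewrite ?scale0r ?mul0r // scale1r mul1r.
Qed.

End Centralizer.

End CentralizerOfJ.

(** * Which exterior coefficients survive the relations *)

Section WeightArgument.
Variables (F : fieldType) (r n : nat) (pi : 'I_(r.*2) -> nat).
Local Notation m := (r.*2).
Local Notation Mon := (Mon n pi).
Local Notation Alpha := (Alpha pi).
Local Notation Ix := (Ix r n).
Local Notation Oalg := {ffun Mon -> F^o}.
Local Notation Wder := {ffun Ix -> Oalg}.
Implicit Types (a b c : Alpha) (i : 'I_m) (u v : {set 'I_n}) (j l : 'I_n).
Implicit Types (f g h : Oalg) (k x : Mon) (q : bool).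
Lemma above_setU1_notin u j l : l \notin u -> above (l |: u) j = ((j < l)%N + above u j)%N.
Proof.
move=> lu; have := card_below_above (l |: u) j; have := card_below_above u j.
rewrite cardsU1 lu below_setU1_notin // !inE -val_eqE /=.
have : (j == l :> nat) -> (j \in u) = false.
  by move=> /eqP/val_inj ->; apply: negbTE.
case: (j \in u); case: ltngtP => //= _ H; move: (below u j) (above u j) (above _ j) #|u|; lia.
Qed.

Lemma jprime_fix j : jprime j = j -> odd n /\ j = n.-1 :> nat.
Proof.
have ltn := ltn_ord j; have nE := odd_double_half n.
rewrite /jprime; have [lt_j|ge_j] := ltnP j n./2.
  move/(congr1 val); rewrite /= val_insubd.
  by rewrite (_ : (j + n./2 < n)%N = true) => /=; lia.
have [lt_j2|ge_j2] := ltnP j n./2.*2; last by lia.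
move/(congr1 val); rewrite /= val_insubd.
by rewrite (_ : (j - n./2 < n)%N = true) => /=; lia.
Qed.

Lemma jprime_last j : odd n -> j = n.-1 :> nat -> jprime j = j.
Proof.
move=> on jE; have nE := odd_double_half n; rewrite /jprime.
rewrite (_ : (j < n./2)%N = false); last by lia.
by rewrite (_ : (j < n./2.*2)%N = false) //; lia.
Qed.

Hypothesis two_neq0 : 2%:R != 0 :> F.

Section Weights.
(** [c l u] plays the coefficient of x^u d_l, that is [wcoef]; the hypotheses are exactly the
    relations proved for it. *)
Variable c : 'I_n -> {set 'I_n} -> F.
Hypothesis c_even : forall l u, odd #|u| -> c l u = 0.
Hypothesis c_rel : forall j l u, j != l ->
  (if l \in u then (-1) ^+ above u l * c j (u :\ l) else 0) =
  (if j \in u then (-1) ^+ above u j * c l (u :\ j) else 0).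
Hypothesis c_torus : forall j l u, j != jprime j ->
  ((jprime j \in u)%:R - (j \in u)%:R) * c l u = ((l == jprime j)%:R - (l == j)%:R) * c l u.

Lemma c_notin j l u : j != l -> j \notin u -> l \notin u -> c j u = 0.
Proof.
move=> neq /negbTE ju lu; have := c_rel (l |: u) neq.
rewrite setU11 setU1K // !inE (negbTE neq) ju => /eqP.
by rewrite mulf_eq0 signr_eq0 => /eqP.
Qed.

(** [c_rel] at [i |: (j |: u)], normalized by signs: for [i < j] the set above [i] also contains
    [j], whereas the set above [j] does not contain [i]. This accounts for the minus. *)
Lemma c_anti u (i j : 'I_n) : i != j -> i \notin u -> j \notin u ->
  (-1) ^+ above u i * c i (i |: u) = - ((-1) ^+ above u j * c j (j |: u)).
Proof.
wlog lt_ij : i j / (i < j)%N.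
  move=> IH neq iu ju; have [lt_ij|lt_ji|ij] := ltngtP i j; first exact: IH.
    by rewrite (IH j i) ?opprK // eq_sym.
  by case/eqP: neq; apply: val_inj.
move=> neq iu ju; have ij : i \notin j |: u by rewrite !inE negb_or neq.
have ji : j \notin i |: u by rewrite !inE negb_or eq_sym neq.
have := c_rel (i |: (j |: u)) neq; rewrite !inE !eqxx orbT /= setU1K // setUCA setU1K //.
rewrite !above_setU1_notin // !ltnn lt_ij ltnNge (ltnW lt_ij) !add0n add1n exprS => E.
have := congr1 (fun z => (-1) ^+ above u i * ((-1) ^+ above u j * z)) E.
rewrite mulrA [in X in _ -> X]mulrC; set A := (-1) ^+ _; set B := (-1) ^+ _ => {E} E.
have AA : A * A = 1 by rewrite -expr2 sqrr_sign.
have BB : B * B = 1 by rewrite -expr2 sqrr_sign.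
transitivity (A * B * (B * c i (i |: u))); first by rewrite mulrA -[A * B * B]mulrA BB mulr1 mulrC.
rewrite E; transitivity (- (A * A) * (B * c j (j |: u))); last by rewrite AA mulN1r.
by ring.
Qed.

(** Removing [i] leaves three indices outside [v]. Following [c_anti] around this triangle changes
    the sign three times and returns to the start, so twice the coefficient is 0. *)
Lemma c_two_missing (i j k : 'I_n) u : i \in u -> j \notin u -> k \notin u -> j != k -> c i u = 0.
Proof.
move=> iu ju ku jk; pose v := u :\ i; have iv : i \notin v by rewrite !inE eqxx.
have jv : j \notin v by rewrite !inE negb_and ju orbT.
have kv : k \notin v by rewrite !inE negb_and ku orbT.
have ij : i != j by apply: contraNneq ju => <-.
have ik : i != k by apply: contraNneq ku => <-.
have := c_anti ij iv jv; rewrite (c_anti jk jv kv) -(c_anti ik iv kv) setD1K //.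
move/eqP; rewrite -subr_eq0 opprK -mulr2n -mulr_natl !mulf_eq0 signr_eq0 (negbTE two_neq0).
by move/eqP.
Qed.

(** If [l] lies in [u], at most one index is missing by [c_two_missing]; otherwise [c_notin] allows
    no missing index besides [l]. *)
Lemma c_supp l u : c l u != 0 -> u = setT \/ exists j, u = ~: [set j].
Proof.
move=> nz; have [lu|lu] := boolP (l \in u).
  have [/eqP|] := boolP (u == setT); first by left.
  rewrite eqEsubset subsetT /= => /subsetPn[j _ ju]; right; exists j.
  apply/setP => k; rewrite !inE; have [->|kj] := eqVneq k j; first exact: negbTE.
  by apply: contraNT nz => ku; rewrite (c_two_missing lu ju ku) // eq_sym.
right; exists l; apply/setP => k; rewrite !inE; have [->|kl] := eqVneq k l; first exact: negbTE.
by apply: contraNT nz => ku; rewrite (@c_notin l k) // eq_sym.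
Qed.

(** The complement of a point has odd size and is excluded by parity. On the full set every torus
    weight is 0, while [d_l] requires weight -1 for the torus element of [l]; a self-paired [l]
    would make [n] odd. *)
Lemma c_n_even l u : ~~ odd n -> c l u = 0.
Proof.
move=> n_even; apply: contraNeq n_even => nz; case: (c_supp nz) => [uT|[j uj]].
  have [/jprime_fix[] //|neq] := eqVneq (jprime l) l.
  rewrite eq_sym in neq; have := c_torus l u neq.
  by rewrite uT !inE subrr mul0r eqxx (negbTE neq) sub0r mulN1r => /esym/eqP;
    rewrite oppr_eq0 -uT (negbTE nz).
have : ~~ odd #|u| by apply: contra nz => ou; rewrite c_even.
by rewrite uj cardsC1 card_ord; case: n j {uj} => [[]|] //= n' _; rewrite negbK.
Qed.

Lemma c_n_odd l u : odd n -> c l u != 0 -> u = ~: [set jprime l].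
Proof.
move=> n_odd nz; have ue : ~~ odd #|u| by apply: contra nz => ou; rewrite c_even.
case: (c_supp nz) => [uT|[j uj]]; first by move: ue; rewrite uT cardsT card_ord n_odd.
(* If the missing index is self-paired and [l] is not, [u] contains both [l] and its partner: the
   torus element of [l] has weight 0 on x^u, but weight -1 is required. *)
rewrite uj; congr (~: [set _]); have [jj|neq] := eqVneq j (jprime j).
  have [ll|neq] := eqVneq l (jprime l).
    have [_ jE] := jprime_fix (esym jj); have [_ lE] := jprime_fix (esym ll).
    by rewrite -ll; apply: val_inj; rewrite /= jE lE.
  have /negbTE jl : l != j by apply: contraNneq neq => lj; apply/eqP; rewrite lj.
  have jl' : (jprime l == j) = false by rewrite {1}jj (inj_eq (inv_inj (@jprimeK n))).
  have := c_torus l u neq; rewrite uj !inE jl' jl eqxx (negbTE neq) subrr mul0r.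
  by rewrite sub0r mulN1r => /esym/eqP; rewrite oppr_eq0 -uj (negbTE nz).
(* Otherwise x^u has weight 1 for the torus element of [j], so [l] must be the partner of [j]; the
   case [l = j] would give c = -c, and any other [l] gives c = 0. *)
have := c_torus l u neq; rewrite uj !inE eqxx /= -{1}uj eq_sym neq subr0 mul1r -uj.
have [->|nl] := eqVneq l (jprime j); first by rewrite jprimeK.
rewrite sub0r; have [lj|_] := eqVneq l j => /eqP; last by rewrite oppr0 mul0r (negbTE nz).
rewrite mulN1r -subr_eq0 opprK -mulr2n -mulr_natl mulf_eq0 (negbTE two_neq0) (negbTE nz) //.
Qed.
End Weights.

End WeightArgument.

(** * From the centralizer to derivations, and the converse construction *)

Section Derivations.
Variables (F : fieldType) (r n : nat) (pi : 'I_(r.*2) -> nat).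
Local Notation m := (r.*2).
Local Notation Mon := (Mon n pi).
Local Notation Alpha := (Alpha pi).
Local Notation Ix := (Ix r n).
Local Notation Oalg := {ffun Mon -> F^o}.
Local Notation Wder := {ffun Ix -> Oalg}.
Implicit Types (a b c : Alpha) (i : 'I_m) (u v : {set 'I_n}) (j l : 'I_n).
Implicit Types (f g h : Oalg) (k x : Mon) (q : bool).
Hypothesis binp : forall i (e : nat), (0 < e <= pi i)%N -> 'C((pi i).+1, e)%:R = 0 :> F.
Hypothesis two_neq0 : 2%:R != 0 :> F.
Hypothesis pi_gt2 : forall i, (2 < pi i)%N.
Hypothesis r_gt0 : (0 < r)%N.
Hypothesis n_gt0 : (0 < n)%N.
Implicit Types (s t : Ix) (X Y w : Wder).
Local Notation xodd := (@xodd F r n pi).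
Local Notation DHpi := (DH F (monPi n pi)).
Local Notation DHomega := (DH F (monXomega n pi)).

Lemma centralizer_n_even w : ~~ odd n -> inW1 w ->
  (forall k, Jidx k -> brW (DH F k) w = 0) -> w = 0.
Proof.
move=> n_even w1 cw; apply/ffunP => -[i|l]; rewrite [RHS]ffunE.
  exact: (centralizer_even pi_gt2 cw).
apply/ffunP => -[a u]; rewrite [RHS]ffunE.
have [->|neq] := eqVneq a (zeroA pi); last exact: (centralizer_zeroA pi_gt2 cw).
apply: (c_n_even two_neq0 (c := wcoef w)) => // *.
- exact: wcoef_even.
- exact: wcoef_rel.
- exact: wcoef_torus.
Qed.

(** [z] is the self-paired index, so the only coefficient [c_n_odd] leaves in its component is the
    one assumed to be 0. The rotation of [l] and [z] then expresses every other component through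
    the one at [z]. *)
Lemma centralizer_n_odd w (z : 'I_n) : odd n -> z = n.-1 :> nat -> inW1 w ->
  (forall k, Jidx k -> brW (DH F k) w = 0) ->
  w (inr z) (zeroA pi, ~: [set z]) = 0 -> w = 0.
Proof.
move=> n_odd zE w1 cw wz0; have zz := jprime_last n_odd zE.
have wz : w (inr z) = 0.
  apply/ffunP => -[a u]; rewrite [RHS]ffunE.
  have [->|neq] := eqVneq a (zeroA pi); last exact: (centralizer_zeroA pi_gt2 cw).
  have [->//|] := eqVneq u (~: [set z]); apply: contraNeq => nz.
  rewrite -[in X in _ == X]zz; apply/eqP; apply: (c_n_odd two_neq0 (c := wcoef w)) nz => // *.
  - exact: wcoef_even.
  - exact: wcoef_rel.
  - exact: wcoef_torus.
apply/ffunP => -[i|l]; rewrite [RHS]ffunE.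
  exact: (centralizer_even pi_gt2 cw).
have [->//|neq] := eqVneq l z.
have lt_lz : (l < z)%N.
  by rewrite ltn_neqAle neq zE /= -ltnS (ltn_predK n_gt0).
have := centralizer_rot pi_gt2 r_gt0 cw z lt_lz.
rewrite zz wz !linear0 add0r eqxx scale1r sub0r => /esym/eqP.
by rewrite oppr_eq0 => /eqP.
Qed.

Lemma pb_suml f h : pb f h = \sum_k f k *: pb (mono F k) h.
Proof.
rewrite /pb; under [RHS]eq_bigr do rewrite scaler_sumr.
rewrite exchange_big; apply: eq_bigr => s _.
rewrite {1}(mono_sum f) (linear_sum (dO s)) -[mulO _ _]/(mulOr _ _) (linear_sum (mulOr _)) scaler_sumr.
apply: eq_bigr => k _; rewrite (linearZ_LR (dO s)) (linearZ_LR (mulOr _)) !scalerA.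
by rewrite mulrC.
Qed.

(** d_j x^omega contains every odd variable except x_j, and an even nonempty index set has an
    element other than [j], so the two factors share a variable. *)
Lemma mulO_mono_dO_omega k j : mon_par k = false -> k.2 != set0 ->
  mulO (mono F k) (dO (inr j) (xodd setT)) = 0.
Proof.
move=> kev k0; pose v : {set 'I_n} := setT :\ j.
have dE : dO (inr j) (xodd setT) = (-1) ^+ below setT j *: xodd v by rewrite dO_mono /= inE.
suff E : mulO (mono F k) (xodd v) = 0 by rewrite dE (linearZ_LR (mulO _)) /= E scaler0.
apply/ffunP => -[a u]; rewrite [RHS]ffunE [LHS]mulO_xoddr; case: ifP => // _.
rewrite monoE; case: eqP => [kE|_]; last by rewrite mulr0.
have : (#|k.2| <= 1)%N.
  rewrite -(cards1 j) -kE; apply/subset_leq_card/subsetP => l.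
  by rewrite !inE andbT negbK => /andP[].
rewrite leq_eqVlt ltnS leqn0 cards_eq0 (negbTE k0) orbF => /eqP k1.
by move: kev; rewrite /mon_par k1.
Qed.

(** For a monomial without odd variables, odd derivatives kill it and even ones kill x^omega. For
    the others, every product under the divergence is already 0. *)
Lemma pb_omega f : homO false f -> pb f (xodd setT) = 0.
Proof.
move=> fq; rewrite pb_suml big1 // => k _.
have [->|/(homO_neq0 fq) kev] := eqVneq (f k) 0; first by rewrite (scale0r (pb _ _)).
suff -> : pb (mono F k) (xodd setT) = 0 by rewrite scaler0.
have kq : homO false (mono F k) by rewrite -kev; apply: homO_mono.
have [k0|k0] := eqVneq k.2 set0.
  rewrite /pb big1 // => -[i|j] _; first by rewrite /= dO_even_xodd linear0 scaler0.
  by rewrite (surjective_pairing k) k0 dO_odd_mono0 mul0O scaler0.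
have Z s : mulO (mono F k) (dO (iprime s) (xodd setT)) = 0.
  case: s => [i|j]; last exact: mulO_mono_dO_omega.
  by rewrite [dO _ _]dO_even_xodd linear0.
rewrite pb_split !(pb_divergence binp two_neq0 _ _ kq).
by rewrite !big1 ?addr0 // => s _; rewrite Z linear0 scaler0.
Qed.

Section OddOmega.
Hypothesis n_odd : odd n.

Lemma DHomegaE : DHomega = DHq true (xodd setT).
Proof. by rewrite DH_DHq /mon_par cardsT card_ord n_odd. Qed.

Lemma homO_omega : homO true (xodd setT).
Proof. by have := @homO_mono F r n pi (monXomega n pi); rewrite /mon_par cardsT card_ord n_odd. Qed.

Lemma brW_omega X (c : F) : inH0 X -> brW X (c *: DHomega) = 0.
Proof.
move=> /inH0P[f [fq _ ->]]; rewrite DHomegaE -linearZ /=.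
rewrite (brW_DHq binp fq (homOZ c homO_omega)) (linearZ_LR (pb f)) /= pb_omega //.
by rewrite scaler0 linear0.
Qed.

(** Since [X] is even, both orders of the bracket are plain commutators of actions and differ only
    by sign. *)
Lemma brW_omegal X (c : F) : inH0 X -> brW (c *: DHomega) X = 0.
Proof.
move=> X0; have eX : evenW X by case/inH0P: X0 => f [fq _ ->]; apply: evenW_DHq.
have := brW_omega c X0; rewrite !brW_act; [|by right|by left].
move/ffunP => E; apply/ffunP => t; have := E t; rewrite !ffunE => /eqP.
by rewrite subr_eq0 => /eqP ->; rewrite subrr.
Qed.

Lemma inW1_omega (c : F) : inW1 (c *: DHomega).
Proof.
move=> s k; rewrite /wpar => wk; rewrite DHomegaE !ffunE /=.
rewrite (homO_dO (s := iprime s) homO_omega) ?scaler0 // ipar_iprime.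
by move: wk; case: (mon_par k); case: ipar.
Qed.

Lemma DHomega_last (z : 'I_n) : z = n.-1 :> nat ->
  DHomega (inr z) (zeroA pi, ~: [set z]) != 0.
Proof.
move=> zE; have zz := jprime_last n_odd zE; rewrite DHomegaE.
have -> : inr z = iprime (inr z : Ix) by rewrite iprime_inr zz.
rewrite DHqE /= mul1r ffun_scaleE dO_odd /= !inE eqxx /= setUCr monoE eqxx mulr1.
by rewrite mulf_neq0 ?signr_eq0 // expr1 oppr_eq0 oner_eq0.
Qed.
End OddOmega.

Lemma homO_monPi : homO false (mono F (monPi n pi)).
Proof. by have := @homO_mono F r n pi (monPi n pi); rewrite /mon_par cards0. Qed.

Lemma mono_monPi_omega : mono F (monPi n pi) (monPiOmega n pi) = 0.
Proof.
rewrite monoE; case: eqP => // /(congr1 (fun k : Mon => #|k.2|)) /=.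
by rewrite cardsT card_ord cards0 => n0; move: n_gt0; rewrite n0.
Qed.

Lemma DHpiE : DHpi = DHq false (mono F (monPi n pi)).
Proof. by rewrite DH_DHq /mon_par cards0. Qed.

Lemma inH0_DHpi : inH0 DHpi.
Proof.
apply/inH0P; exists (mono F (monPi n pi)); split; last exact: DHpiE.
  exact: homO_monPi.
exact: mono_monPi_omega.
Qed.

Lemma inJ_inH0 X : inJ X -> inH0 X.
Proof. by move=> /inJP[f [fq f0 _ ->]]; apply/inH0P; exists f. Qed.

Lemma inJ_DH k : Jidx k -> inJ (DH F k).
Proof.
move=> Jk; exists (fun l : Mon => mono F k l); rewrite (bigD1 k) //= monoE eqxx scale1r.
by rewrite big1 ?addr0 // => l /andP[_ /negbTE neq]; rewrite monoE neq scale0r.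
Qed.

Lemma DHqB q f g (c : F) : DHq q (f - c *: g) = DHq q f - c *: DHq q g.
Proof. by rewrite linearB linearZ. Qed.

Lemma inH0_split X : inH0 X -> exists (c : F) Y, inJ Y /\ X = c *: DHpi + Y.
Proof.
move=> /inH0P[f [fq f0 ->]].
exists (f (monPi n pi)), (DHq false (f - f (monPi n pi) *: mono F (monPi n pi))); split.
  have subE (g h : Oalg) (d : F) x : (g - d *: h) x = g x - d * h x by rewrite !ffunE.
  apply/inJP; exists (f - f (monPi n pi) *: mono F (monPi n pi)); split=> //.
  - rewrite -scaleNr; apply: homOD => //; apply: homOZ; exact: homO_monPi.
  - by rewrite subE f0 mono_monPi_omega mulr0 subr0.
  by rewrite subE monoE eqxx mulr1 subrr.
by rewrite DHpiE DHqB addrC subrK.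
Qed.

Lemma brW0l Y : brW 0 Y = 0.
Proof.
rewrite brW_act; last by left=> s k _; rewrite !ffunE.
apply/ffunP => t; rewrite !ffunE linear0 subr0 /act big1 // => s _.
by rewrite ffunE mul0O.
Qed.

(** The bracket of [DH F k] with D_H(x^(pi)) lies in J, so [phi] kills it; since [phi] also kills
    [DH F k], the derivation rule leaves a single term. *)
Lemma derivation_centralizes (phi : Wder -> Wder) : is_derivation phi ->
  (forall X, inJ X -> phi X = 0) -> forall k, Jidx k -> brW (DH F k) (phi DHpi) = 0.
Proof.
move=> [_ phiM] phiJ k /inJ_DH Jk; have Hk := inJ_inH0 Jk.
have E := etrans (esym (phiJ _ (inJ_brW binp two_neq0 Hk inH0_DHpi))) (phiM _ _ Hk inH0_DHpi).
have E0 := etrans (congr1 (fun Z => brW Z DHpi) (phiJ _ Jk)) (brW0l _).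
exact: etrans (esym (add0r _)) (etrans (congr1 (fun Z => Z + _) (esym E0)) (esym E)).
Qed.

Lemma brWBr X Y Z : evenW X -> brW X (Y - Z) = brW X Y - brW X Z.
Proof.
move=> eX; have E T : brW X T = [ffun t => act X (T t) - act T (X t)] by apply: brW_act; left.
rewrite !E; apply/ffunP => t; rewrite !ffunE linearB /=.
suff -> : act (Y - Z) (X t) =
  act Y (X t) - act Z (X t) by rewrite opprB addrACA opprB [RHS]addrACA [- act Y _ + _]addrC.
rewrite -sumrB; apply: eq_bigr => s _.
by rewrite !ffunE -[LHS]/(mulOr _ _) (linearB (mulOr _)).
Qed.

Lemma derivation_n_even (phi : Wder -> Wder) : is_derivation phi ->
  (forall X, inJ X -> phi X = 0) -> ~~ odd n -> forall X, inH0 X -> phi X = 0.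
Proof.
move=> dphi phiJ n_even X /inH0_split[c [Y [JY ->]]].
have [[phiD phiW] _] := dphi.
have w0 := centralizer_n_even n_even (phiW _ inH0_DHpi) (derivation_centralizes dphi phiJ).
apply: etrans (phiD c _ _ inH0_DHpi (inJ_inH0 JY)) _.
by rewrite w0 (phiJ _ JY) scaler0 addr0.
Qed.

Lemma subWE Y Z (c : F) s k : (Y - c *: Z) s k = Y s k - c * Z s k.
Proof. by rewrite !ffunE. Qed.

Lemma derivation_n_odd (phi : Wder -> Wder) : is_derivation phi ->
  (forall X, inJ X -> phi X = 0) -> odd n -> exists mu : F, phi DHpi = mu *: DHomega.
Proof.
move=> dphi phiJ n_odd; have [[_ phiW] _] := dphi.
have lt_z : (n.-1 < n)%N by rewrite prednK.
pose z := Ordinal lt_z; pose w := phi DHpi; pose x : Mon := (zeroA pi, ~: [set z]).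
have nz : DHomega (inr z) x != 0 by apply: DHomega_last.
(* [mu] is chosen so that subtracting [mu *: DHomega] clears the one coefficient that
   [centralizer_n_odd] needs to be 0. *)
pose mu : F := w (inr z) x / DHomega (inr z) x.
exists mu; apply/eqP; rewrite -subr_eq0; apply/eqP.
have W1 : inW1 (w - mu *: DHomega).
  move=> s k wk; apply: etrans (subWE _ _ _ _ _) _.
  have o0 : DHomega s k = 0 by have := inW1_omega n_odd 1 wk; rewrite scale1r.
  by rewrite o0 mulr0 subr0; apply: (phiW _ inH0_DHpi).
apply: (centralizer_n_odd (z := z) n_odd erefl W1) => [k Jk|].
  have Hk := inJ_inH0 (inJ_DH Jk).
  have eX : evenW (DH F k) by case/inH0P: Hk => f [fq _ ->]; apply: evenW_DHq.
  apply: etrans (brWBr _ _ eX) (etrans (congr2 (fun A B => A - B) _ _) (subrr 0)).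
    exact: derivation_centralizes.
  exact: brW_omega.
by apply: etrans (subWE _ _ _ _ _) _; rewrite divfK // subrr.
Qed.

Section Converse.
Hypothesis n_odd : odd n.
Variable mu : F.

(** Both sides of the derivation rule are 0: brackets lie in J, and all values of [phi] on [inH0]
    are multiples of D_H(x^omega), which commute with it. *)
Lemma omega_map_derivation (phi : Wder -> Wder) : lin_H0_W1 phi ->
  (forall X, inJ X -> phi X = 0) -> phi DHpi = mu *: DHomega -> is_derivation phi.
Proof.
move=> lphi phiJ phiD; split=> // X Y HX HY; have [phiL _] := lphi.
have phi_omega Z : inH0 Z -> exists c : F, phi Z = c *: DHomega.
  move=> /inH0_split[c [T [JT ->]]]; exists (c * mu).
  by rewrite phiL ?phiD ?phiJ ?addr0 ?scalerA //; [exact: inH0_DHpi|exact: inJ_inH0].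
rewrite phiJ; last exact: inJ_brW.
have [c ->] := phi_omega X HX; have [d ->] := phi_omega Y HY.
by rewrite brW_omegal // brW_omega // addr0.
Qed.

Let i0 : 'I_m := Ordinal (etrans (double_gt0 r) r_gt0).
(** The component of D_H(f) at the partner of [i0] is [d_i0 f], so its coordinate at pi - eps_i0
    recovers the coefficient of x^(pi) in [f]. This makes [Gamma] given by a formula on all of W,
    independent of the choice of Hamiltonian. *)
Let topA : Mon := (setA (piA pi) i0 (pi i0).-1, set0).

Lemma DHq_top f : DHq false f (iprime (inl i0)) topA = f (monPi n pi).
Proof.
have le_pi : ((pi i0).-1 <= pi i0)%N := leq_pred _.
have pi_pos : (0 < pi i0)%N := ltnW (ltnW (pi_gt2 i0)).
rewrite DHqE /= r_gt0 mulr1 scale1r dO_even /= (aval_setA _ le_pi) eqxx prednK // leqnn.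
by rewrite (setA_idem _ le_pi (leqnn _)) -(aval_piA pi i0) setA_aval.
Qed.

Definition Gamma X : Wder := X (iprime (inl i0)) topA *: (mu *: DHomega).

Lemma Gamma_lin : lin_H0_W1 Gamma.
Proof.
split=> [c X Y _ _|X _ s k wk].
  have E : (c *: X + Y) (iprime (inl i0)) topA =
    c * X (iprime (inl i0)) topA + Y (iprime (inl i0)) topA.
    by rewrite !ffunE.
  by rewrite /Gamma E scalerDl -scalerA.
by rewrite /Gamma scalerA; apply: inW1_omega.
Qed.

Lemma Gamma_inJ X : inJ X -> Gamma X = 0.
Proof. by move=> /inJP[f [_ _ f1 ->]]; rewrite /Gamma DHq_top f1 scale0r. Qed.

Lemma Gamma_DHpi : Gamma DHpi = mu *: DHomega.
Proof.
by rewrite DHpiE /Gamma DHq_top monoE eqxx scale1r.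
Qed.
End Converse.

End Derivations.

Unset Implicit Arguments.

(** From k C(p^t, k) = p^t C(p^t - 1, k - 1): if p did not divide C(p^t, k), then p^t would divide
    k, which is smaller. *)
Lemma bin_prime_power_pchar (F : fieldType) (p t k : nat) :
  p \in [pchar F] -> (0 < k < p ^ t)%N -> 'C(p ^ t, k)%:R = 0 :> F.
Proof.
move=> pF /andP[k_gt0 lt_k]; have p_pr : prime p by case/andP: pF.
apply/eqP; rewrite -(dvdn_pcharf pF); apply/negP => /negP ndvd.
have co : coprime (p ^ t) 'C(p ^ t, k) by rewrite coprimeXl // prime_coprime.
have : (p ^ t %| k)%N.
  rewrite -(Gauss_dvdl _ co) -(prednK k_gt0) -mul_bin_diag.
  exact: dvdn_mulr.
by move/(dvdn_leq k_gt0); rewrite leqNgt lt_k.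
Qed.

(** The conditions on [Gamma] concern only its values on [inH0], so the existence of such a map and
    the derivation property of every such map are separate clauses. *)
Theorem theorem3p4 (F : closedFieldType) (p r n : nat) (t : 'I_(r.*2) -> nat)
  (Hchar : p \in [pchar F]) (Hp3 : (3 < p)%N) (Hr : (0 < r)%N) (Hn : (0 < n)%N)
  (Ht : forall i, (0 < t i)%N) :
  let pi := fun i : 'I_(r.*2) => (p ^ t i).-1 in
  let DHpi := @DH F r n pi (@monPi r n pi) in
  let DHomega := @DH F r n pi (@monXomega r n pi) in
  (forall phi, is_derivation phi -> (forall x, inJ x -> phi x = 0) ->
     (~~ odd n -> forall x, inH0 x -> phi x = 0) /\
     (odd n -> exists mu : F, phi DHpi = mu *: DHomega)) /\
  (odd n -> forall mu : F,
     (exists Gamma, lin_H0_W1 Gamma /\ (forall x, inJ x -> Gamma x = 0) /\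
                    Gamma DHpi = mu *: DHomega) /\
     (forall Gamma, lin_H0_W1 Gamma -> (forall x, inJ x -> Gamma x = 0) ->
                    Gamma DHpi = mu *: DHomega -> is_derivation Gamma)).
Proof.
move=> pi DHpi DHomega; have p_pr : prime p by case/andP: Hchar.
have piS i : (pi i).+1 = (p ^ t i)%N by rewrite prednK // expn_gt0 prime_gt0.
have binp i (e : nat) : (0 < e <= pi i)%N -> 'C((pi i).+1, e)%:R = 0 :> F.
  move=> /andP[e_gt0 le_e]; rewrite piS; apply: bin_prime_power_pchar => //.
  by rewrite e_gt0 -piS ltnS.
have two_neq0 : 2%:R != 0 :> F.
  by rewrite -(dvdn_pcharf Hchar); apply/negP => /dvdn_leq; lia.
(* Since [t i] is positive, [(pi i).+1 = p ^ t i] is at least [p], hence greater than 3. *)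
have pi_gt2 i : (2 < pi i)%N.
  rewrite -ltnS piS; apply: leq_trans Hp3 _; rewrite -{1}[p]expn1.
  by apply: leq_pexp2l (Ht i); apply: prime_gt0.
split=> [phi dphi phiJ|n_odd mu]; first split=> n_par.
- exact: (derivation_n_even binp two_neq0 pi_gt2 Hr Hn dphi phiJ n_par).
- exact: (derivation_n_odd binp two_neq0 pi_gt2 Hr Hn dphi phiJ n_par).
split.
  exists (Gamma Hr mu); split; first exact: (Gamma_lin _ Hr n_odd mu).
  split; first exact: (Gamma_inJ pi_gt2).
  exact: (Gamma_DHpi n pi_gt2 Hr mu).
exact: (omega_map_derivation binp two_neq0 Hn n_odd).
Qed.
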